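(* Let $n\ge1$, let $W:\mathbb{R}^n\to[0,\infty)$ and $a^-,a^+\in\mathbb{R}^n$ with $W(a^\pm)=0$, and let $\Sigma:=\{W=0\}$. Assume: (A1) $W\in C^2(\mathbb{R}^n)$ and the Hessian $\nabla^2W$ is bounded from below on $\mathbb{R}^n$; (A2) $\Sigma$ is finite; (A3) for all $x\in\mathbb{R}^n$, $W(x)\ge k^2(d(x,\Sigma))$ for some function $k\in C^0(\mathbb{R}^+,\mathbb{R}^+)$ with $\int_0^\infty k(t)\,dt=+\infty$; (A4) there exist $r_0>0$, $c_0>0$ and $p_0\in[2,6)$ such that $\nabla W(x)\cdot(x-a^\pm)\ge c_0|x-a^\pm|^{p_0}$ for all $x\in B(a^\pm,r_0)$. Then there exists $\varepsilon_0\in(0,1)$, depending only on $W$, $c_0$ and $p_0$, such that the following holds true. Let $v\in H^1_{loc}(\mathbb{R},\mathbb{R}^n)$ satisfy $\mathfrak{E}_W(v)<\infty$ and $v(s_0)\in B(a^+,\varepsilon_0)$ for some $s_0\in\mathbb{R}$. Take $c\in(0,c_0)$. Then one has $\mathfrak{E}_W(P[v])\le\mathfrak{E}_W(v)$, where $$P[v](s):=\begin{cases}a^++E(s)\,\dfrac{v(s)-a^+}{|v(s)-a^+|}&\text{if }s>s_0\text{ and }|v(s)-a^+|>E(s),\\[2mm] v(s)&\text{otherwise,}\end{cases}$$ and where $E:[s_0,+\infty)\to\mathbb{R}^+$ is the solution of $$E''=cE^{p_0-1},\qquad E(s_0)=\varepsilon_0,\qquad \lim_{s\to+\infty}E(s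)=0.$$
   Context: For $v\in H^1_{loc}(\mathbb{R},\mathbb{R}^n)$, $\mathfrak{E}_W(v)=\int_{\mathbb{R}}\left(\frac12|\dot v(t)|^2+W(v(t))\right)dt$. $B(a,r)$ denotes the open Euclidean ball of center $a$ and radius $r$; $d(x,\Sigma)$ is the Euclidean distance from $x$ to $\Sigma$; $\mathbb{R}^+=[0,\infty)$.
   Formalization: The constant c in (0,c_0) is fixed before ε_0, so ε_0 may depend on c as well as on W, c_0 and p_0; a single ε_0 valid for all c in (0,c_0) is impossible, since the energy of P[v] can blow up as c tends to 0. *)

(* Defs.v *)
From HB Require Import structures.
From mathcomp Require Import all_boot all_order all_algebra.
From mathcomp Require Import all_classical all_reals all_analysis.

Set Implicit Arguments.
Unset Strict Implicit.
Unset Printing Implicit Defensive.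

Import Order.TTheory GRing.Theory Num.Theory.
Import numFieldNormedType.Exports.

Local Open Scope classical_set_scope.
Local Open Scope ring_scope.

(* The library norm `|x| on 'rV[R]_n is the sup norm, hence the Euclidean
   structure is introduced here; the two norms induce the same topology. *)
Definition dot (R : realType) (n : nat) (x y : 'rV[R]_n) : R :=
  \sum_(i < n) x 0 i * y 0 i.

Definition enorm (R : realType) (n : nat) (x : 'rV[R]_n) : R :=
  Num.sqrt (dot x x).

Definition eball (R : realType) (n : nat) (a : 'rV[R]_n) (r : R) :
    set 'rV[R]_n :=
  [set x | enorm (x - a) < r].

Definition edist (R : realType) (n : nat) (x : 'rV[R]_n) (S : set 'rV[R]_n) :
    R :=
  inf [set enorm (x - y) | y in S].

Definition partial (R : realType) (n : nat) (i : 'I_n) (W : 'rV[R]_n -> R) :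
    'rV[R]_n -> R :=
  fun x => 'D_(delta_mx 0 i) W x.

Definition grad (R : realType) (n : nat) (W : 'rV[R]_n -> R) (x : 'rV[R]_n) :
    'rV[R]_n :=
  \row_i partial i W x.

Definition hessian (R : realType) (n : nat) (W : 'rV[R]_n -> R)
    (x : 'rV[R]_n) : 'M[R]_n :=
  \matrix_(i, j) partial j (partial i W) x.

Definition has_continuous_partials (R : realType) (n : nat)
    (W : 'rV[R]_n -> R) : Prop :=
  forall i : 'I_n,
    (forall x, derivable W x (delta_mx 0 i)) /\ continuous (partial i W).

Definition C2 (R : realType) (n : nat) (W : 'rV[R]_n -> R) : Prop :=
  [/\ continuous W, has_continuous_partials W &
      forall i : 'I_n, has_continuous_partials (partial i W)].

Definition hessian_bounded_below (R : realType) (n : nat)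
    (W : 'rV[R]_n -> R) : Prop :=
  exists m : R, forall x xi : 'rV[R]_n,
    m * dot xi xi <= (xi *m hessian W x *m xi^T) 0 0.

Definition zero_set (R : realType) (n : nat) (W : 'rV[R]_n -> R) :
    set 'rV[R]_n :=
  [set x | W x = 0].

Definition nonintegrable_minorant (R : realType) (n : nat)
    (W : 'rV[R]_n -> R) : Prop :=
  exists k : R -> R,
    [/\ {within `[0, +oo[, continuous k},
        forall t, 0 <= t -> 0 <= k t,
        (\int[lebesgue_measure]_(t in `[0%R, +oo[) (k t)%:E = +oo)%E &
        forall x, (k (edist x (zero_set W))) ^+ 2 <= W x].

Definition radially_monotone_near (R : realType) (n : nat)
    (W : 'rV[R]_n -> R) (a : 'rV[R]_n) (r0 c0 p0 : R) : Prop :=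
  forall x, eball a r0 x ->
    c0 * enorm (x - a) `^ p0 <= dot (grad W x) (x - a).

Definition L2loc (R : realType) (n : nat) (f : R -> 'rV[R]_n) : Prop :=
  forall i : 'I_n,
    measurable_fun [set: R] (fun t => f t 0 i) /\
    locally_integrable [set: R] (fun t => f t 0 i ^+ 2).

(* phi is in C_c^oo(R). *)
Definition test_function (R : realType) (phi : R -> R) : Prop :=
  (forall (k : nat) (x : R), derivable (derive1n k phi) x 1) /\
  exists M : R, forall x, M < `|x| -> phi x = 0.

Definition is_weak_derivative (R : realType) (n : nat)
    (v g : R -> 'rV[R]_n) : Prop :=
  forall (phi : R -> R) (i : 'I_n), test_function phi ->
    \int[lebesgue_measure]_(t in [set: R]) (v t 0 i * derive1 phi t) =
    - \int[lebesgue_measure]_(t in [set: R]) (g t 0 i * phi t).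

Definition L2loc_weak_derivative (R : realType) (n : nat)
    (v : R -> 'rV[R]_n) : set (R -> 'rV[R]_n) :=
  [set g | L2loc g /\ is_weak_derivative v g].

(* An element of H^1_loc is represented by its continuous representative,
   the one that is meant when a pointwise value such as v(s0) is taken. *)
Definition H1loc (R : realType) (n : nat) (v : R -> 'rV[R]_n) : Prop :=
  [/\ continuous v, L2loc v & L2loc_weak_derivative v !=set0].

(* A choice of L^2_loc weak derivative (unique almost everywhere), and the null
   function when there is none. *)
Definition wderiv (R : realType) (n : nat) (v : R -> 'rV[R]_n) :
    R -> 'rV[R]_n :=
  xget (fun=> 0) (L2loc_weak_derivative v).

(* Only meaningful for v in H^1_loc. *)
Definition energy (R : realType) (n : nat) (W : 'rV[R]_n -> R)
    (v : R -> 'rV[R]_n) : \bar R :=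
  (\int[lebesgue_measure]_(t in [set: R])
     (2^-1 * enorm (wderiv v t) ^+ 2 + W (v t))%:E)%E.

(* E is only relevant on [s0, +oo[; E'' is prescribed in the interior, and E
   is continuous up to s0 (so that E is automatically C^2 up to s0). *)
Definition envelope (R : realType) (c p0 eps0 s0 : R) (E : R -> R) : Prop :=
  [/\ forall s, s0 <= s -> 0 <= E s,
      {within `[s0, +oo[, continuous E},
      forall s, s0 < s ->
        [/\ derivable E s 1, derivable (derive1 E) s 1 &
            derive1 (derive1 E) s = c * E s `^ (p0 - 1)],
      E s0 = eps0 &
      E s @[s --> +oo] --> (0 : R)].

Definition projP (R : realType) (n : nat) (a : 'rV[R]_n) (s0 : R)
    (E : R -> R) (v : R -> 'rV[R]_n) : R -> 'rV[R]_n :=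
  fun s =>
    if (s0 < s) && (E s < enorm (v s - a))
    then a + (E s / enorm (v s - a)) *: (v s - a)
    else v s.

(* Main.v *)
Require Import Defs.
From HB Require Import structures.
From mathcomp Require Import all_boot all_order all_algebra.
From mathcomp Require Import all_classical all_reals all_analysis.
From mathcomp Require Import measurable_realfun.
From mathcomp Require Import ring lra.
Set Implicit Arguments.
Unset Strict Implicit.
Unset Printing Implicit Defensive.
Import Order.TTheory GRing.Theory Num.Theory.
Import numFieldNormedType.Exports.
Local Open Scope classical_set_scope.
Local Open Scope ring_scope.

(** The proof is a calibration. Let x = v - a, rho = |x|, let w be the
projection P[v], and let e(u) = |u'|^2 / 2 + W(u) be the energy density. The
function [calib s rho] is such that psi(s) = calib s (rho s)
- satisfies psi' <= e(v) - e(w) at almost every s > s0 ([calib_pointwise]),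
- vanishes just after s0, where rho < E and hence w = v,
- is at least E'(s) r / 2, which tends to 0, as s tends to infinity.
Integrating psi' gives the energy inequality ([edens_after]), with no need to
split {rho > E} into intervals.

The envelope has the first integral E'^2 / 2 = (c / p) E^p, that is
E' = - mu E^(p / 2) with mu^2 = 2 c / p ([envelope_derive]). Where rho <= E the
curves coincide and e(v) = e(w); where rho > E the projection contracts the
angular velocity, so |w'|^2 <= |v'|^2 - rho'^2 + E'^2 ([projection_speed]), and
psi only has to satisfy psi' <= (rho'^2 - E'^2) / 2 + W(v) - W(w). There, calib
is the maximum of a and min(b, d), where
- a = E' (rho - E), used while v is close to the well: psi' is bounded by
  rho'^2 / 2 - E'^2 / 2 + c E^(p - 1) (rho - E), and W grows radially at least
  at the rate c0 t^(p - 1), with c0 > c;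
- b = B E^(3 - p / 2), a reserve of energy whose rate of decrease,
  (mu^2 / 2 + M) E^2, pays for the whole energy E'^2 / 2 + W(w) of the radial
  motion of w, because W <= M |x|^2 near the well. It is used when v is far
  away, where nothing but W(v) >= 0 is known. It is small for small E because
  p < 6: this is the convergence of the integral of E^2;
- d = lam (rho - r / 2), used while v crosses the annulus r / 4 <= rho < r.
  There W(v) is bounded below, so that the crossing pays for the reserve,
  once the initial radius of the envelope is small.
At a point of differentiability psi' is the derivative of any branch that
attains psi, since functions that touch have the same derivative
([isD_touch]).

All this is done for curves in H1loc, through a concrete form of absolute
continuity: |f t - f s| is at most the integral of a fixed integrable function
over [s, t] ([ac_on]). This class contains the coordinates of v, by the lemma of
du Bois-Reymond ([weak_derivative_primitive]); it is stable under Lipschitz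
combinations, products, maxima and minima, hence contains the coordinates of w
and psi; and its members are integrals of their derivatives
([ac_on_primitive], [primitive_derive]). Conversely the a.e. derivative of such a
function is a weak derivative ([ac_weak_derivative]), so w is in H1loc. *)

(** * Derivatives of real functions *)
Section derivation_rules.
Context {R : realType}.
Implicit Types (f g : R -> R) (x a b c : R).

Lemma isD_eq f x a b : is_derive x 1 f a -> a = b -> is_derive x 1 f b.
Proof. by move=> ? <-. Qed.

Lemma isD_cst c x : is_derive x 1 (fun=> c) 0.
Proof. exact: is_derive_cst. Qed.

Lemma isD_id x : is_derive x 1 (fun t : R => t) 1.
Proof. exact: is_derive_id. Qed.

Lemma isD_add f g x a b : is_derive x 1 f a -> is_derive x 1 g b ->
  is_derive x 1 (fun t => f t + g t) (a + b).
Proof. by move=> fa gb; exact: is_deriveD. Qed.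

Lemma isD_opp f x a : is_derive x 1 f a -> is_derive x 1 (fun t => - f t) (- a).
Proof. by move=> fa; exact: is_deriveN. Qed.

Lemma isD_sub f g x a b : is_derive x 1 f a -> is_derive x 1 g b ->
  is_derive x 1 (fun t => f t - g t) (a - b).
Proof. by move=> fa gb; exact: is_deriveB. Qed.

Lemma isD_mul f g x a b : is_derive x 1 f a -> is_derive x 1 g b ->
  is_derive x 1 (fun t => f t * g t) (f x * b + g x * a).
Proof. by move=> fa gb; exact: is_deriveM. Qed.

Lemma isD_scale c f x a : is_derive x 1 f a ->
  is_derive x 1 (fun t => c * f t) (c * a).
Proof.
by move=> fa; apply: isD_eq (isD_mul (isD_cst c x) fa) _; rewrite mulr0 addr0.
Qed.

Lemma isD_comp f g x a b : is_derive (g x) 1 f a -> is_derive x 1 g b ->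
  is_derive x 1 (fun t => f (g t)) (a * b).
Proof. by move=> fa gb; exact: is_derive1_comp. Qed.

Lemma isD_inv f x a : f x != 0 -> is_derive x 1 f a ->
  is_derive x 1 (fun t => (f t)^-1) (- (f x) ^- 2 * a).
Proof. by move=> f0 fa; apply: isD_eq (is_deriveV f0 fa) _. Qed.

Lemma isD_exp f n x a : is_derive x 1 f a ->
  is_derive x 1 (fun t => f t ^+ n) (n%:R * f x ^+ n.-1 * a).
Proof.
move=> fa; elim: n => [|n IH].
  by rewrite !mul0r; exact: isD_cst.
rewrite (_ : (fun t => _) = (fun t => f t * f t ^+ n)); last first.
  by apply/funext => t; rewrite exprS.
apply: isD_eq (isD_mul fa IH) _; case: n {IH} => [|n] /=.
  by rewrite !expr0; ring.
by rewrite exprS -[in RHS](addn1 n.+1) natrD; ring.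
Qed.

Lemma isD_sum (I : finType) (F : I -> R -> R) (a : I -> R) x :
  (forall i, is_derive x 1 (F i) (a i)) ->
  is_derive x 1 (fun t => \sum_i F i t) (\sum_i a i).
Proof.
move=> H; rewrite [X in is_derive _ _ X _](_ : _ = \sum_i F i); last first.
  by apply/funext => t; rewrite fct_sumE.
elim: (index_enum I) => [|i r IH]; first by rewrite !big_nil; exact: is_derive_cst.
by rewrite !big_cons; exact: is_deriveD.
Qed.

Lemma isD_near f g x a : (\near x, f x = g x) -> is_derive x 1 f a ->
  is_derive x 1 g a.
Proof. exact: near_eq_is_derive. Qed.

Lemma isD_derivable f x a : is_derive x 1 f a -> derivable f x 1.
Proof. by case. Qed.

Lemma isD_derive1 f x : derivable f x 1 -> is_derive x 1 f (derive1 f x).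
Proof. by move=> fx; split => //; rewrite derive1E. Qed.

Lemma isD_unique f x a b : is_derive x 1 f a -> is_derive x 1 f b -> a = b.
Proof. by case=> _ <- [_ <-]. Qed.

Lemma isD_continuous f x a : is_derive x 1 f a -> {for x, continuous f}.
Proof. by case=> fx _; exact/differentiable_continuous/derivable1_diffP. Qed.

Lemma isD_epsP f x a : is_derive x 1 f a <->
  forall e, 0 < e -> \forall s \near (0:R), `|f (s + x) - f x - a * s| <= e * `|s|.
Proof.
split=> [[fx fa] e e0|H].
  have /cvg_ex[l /= fl] := fx.
  have la : l = a by rewrite -fa; apply/esym/cvg_lim.
  move: fl; rewrite la => /cvgrPdist_le/(_ _ e0).
  rewrite /dnbhs /within/= => fl; near=> s.
  have [->|s0] := eqVneq s 0; first by rewrite add0r subrr mulr0 subrr normr0 mulr0.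
  have : `|a - s^-1 *: (f (s *: 1 + x) - f x)| <= e.
    by move: s0; near: s; exact: fl.
  rewrite [s *: 1]mulr1 /GRing.scale/= => se.
  have -> : f (s + x) - f x - a * s = - s * (a - s^-1 * (f (s + x) - f x)).
    by field.
  by rewrite normrM normrN mulrC ler_wpM2r.
have fl : s^-1 *: (f (s *: 1 + x) - f x) @[s --> (0:R)^'] --> a.
  apply/cvgrPdist_le => e e0; rewrite near_withinE; near=> s => s0.
  rewrite [s *: 1]mulr1 /GRing.scale/=.
  have -> : a - s^-1 * (f (s + x) - f x) = - s^-1 * (f (s + x) - f x - a * s).
    by field.
  rewrite normrM normrN normfV mulrC ler_pdivrMr ?normr_gt0//.
  by near: s; exact: H.
by split; [apply/cvg_ex; exists a|apply/cvg_lim].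
Unshelve. all: by end_near. Qed.

(** The difference has a local minimum, so its derivative vanishes. It is used
at the points where a maximum, a minimum or the projection switches from one
formula to another. *)
Lemma isD_touch f g x a b : (\forall t \near x, f t <= g t) -> f x = g x ->
  is_derive x 1 f a -> is_derive x 1 g b -> a = b.
Proof.
move=> fg fgx fa gb; have /isD_epsP H := isD_sub gb fa.
have [//|anb] := eqVneq a b; exfalso.
have ab : b - a != 0 by rewrite subr_eq0 eq_sym.
have e0 : 0 < `|b - a| / 2 by rewrite divr_gt0// normr_gt0.
have {}fg : \forall s \near (0:R), f (s + x) <= g (s + x).
  have sx : (s + x) @[s --> (0:R)] --> x.
    by rewrite -[X in _ --> X]add0r; apply: cvgD; [exact: cvg_id|exact: cvg_cst].
  exact: (sx _ fg).
have [d /= d0 Hd] : \forall s \near (0:R), f (s + x) <= g (s + x) /\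
    `|g (s + x) - f (s + x) - (g x - f x) - (b - a) * s| <= `|b - a| / 2 * `|s|.
  by near=> s; split; near: s; [exact: fg|exact: H].
pose s := - Num.sg (b - a) * (d / 2).
have [] := Hd s.
  rewrite /ball/= sub0r normrN /s normrM normrN normr_sg ab mul1r gtr0_norm ?divr_gt0//.
  by rewrite ltr_pdivrMr// ltr_pMr// ltr1n.
have sE : (b - a) * s = - (`|b - a| * (d / 2)) by rewrite /s normrEsg; ring.
have sn : `|s| = d / 2.
  by rewrite /s normrM normrN normr_sg ab mul1r gtr0_norm ?divr_gt0.
rewrite fgx subrr subr0 sE opprK sn => h1 h2.
have := le_trans (ler_norm _) h2; have := mulr_gt0 e0 d0; set u := g _ in h1 *; set w := f _ in h1 *.
nra.
Unshelve. all: by end_near. Qed.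

Lemma isD_quadratic f x C : (\forall s \near (0:R), `|f (s + x) - f x| <= C * s ^+ 2) ->
  is_derive x 1 f 0.
Proof.
move=> H; apply/isD_epsP => e e0; near=> s.
rewrite mul0r subr0.
apply: (@le_trans _ _ (C * s ^+ 2)); first by near: s.
rewrite (_ : s ^+ 2 = `|s| * `|s|) ?mulrA ?ler_wpM2r//; last first.
  by rewrite -expr2 real_normK// num_real.
apply: (@le_trans _ _ ((`|C| + 1) * `|s|)).
  by rewrite ler_wpM2r// (le_trans (ler_norm _))// lerDl.
rewrite mulrC -ler_pdivlMr ?ltr_wpDl//.
near: s; apply: (@pseudometric_normed_Zmodule.nbhs0_le _ R); apply: divr_gt0 => //; exact: ltr_wpDl.
Unshelve. all: by end_near. Qed.

End derivation_rules.

(** * Densities of monotone functions *)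
Section monotone.
Context {R : realType}.
Notation mu := (@lebesgue_measure R).
Variable k : R -> R.
Hypothesis k0 : forall x, 0 <= k x.
Hypothesis ki : mu.-integrable setT (EFin \o k).

Definition density_measure (A : set (measurableTypeR R)) : \bar R :=
  (\int[mu]_(x in A) (k x)%:E)%E.
Local Notation nu := density_measure.

Let nu0 : nu set0 = 0%E.
Proof. by rewrite /nu integral_set0. Qed.

Let nu_ge0 A : (0 <= nu A)%E.
Proof. by rewrite /nu integral_ge0//= => x _; rewrite lee_fin. Qed.

Let nu_sigma_additive : semi_sigma_additive nu.
Proof.
move=> /= F mF tF mUF; rewrite /nu; apply: cvg_toP.
  apply: ereal_nondecreasing_is_cvgn => m n mn.
  by apply: lee_sum_nneg_natr => // i _ _; exact: nu_ge0.
rewrite ge0_integral_bigcup//=.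
- by apply: measurable_funS (measurable_int mu ki) => //; exact: bigcup_measurable.
- by move=> x _; rewrite lee_fin.
Qed.

HB.instance Definition _ := isMeasure.Build _ _ _
  nu nu0 nu_ge0 nu_sigma_additive.

(** Radon-Nikodym for the Stieltjes measure of G. It is dominated by Lebesgue
measure because adding to it the Stieltjes measure of H - G gives the measure
of density k: the two measures agree on half-open intervals. *)
Lemma monotone_density (G H : R -> R) :
  {homo G : x y / x <= y} -> continuous G -> continuous H ->
  {homo (H \- G) : x y / x <= y} ->
  (forall x y, x <= y -> density_measure `]x, y] = (H y - H x)%:E) ->
  exists g : R -> R, mu.-integrable setT (EFin \o g) /\
    forall x y, x <= y -> G y - G x = \int[mu]_(t in `]x, y]) g t.
Proof.
move=> ndG cG cH ndHG nuE.
have rc (f : R -> R) : continuous f -> forall x, f @ at_right x --> f x.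
  by move=> cf x; apply: cvg_within_filter; exact: cf.
have ndH : {homo H : x y / x <= y}.
  by move=> x y xy; have := ndHG _ _ xy; have := ndG _ _ xy => /=; lra.
pose cuG : cumulative R R := HB.pack G (isCumulative.Build _ _ _ G ndG (rc _ cG)).
pose cuH : cumulative R R := HB.pack H (isCumulative.Build _ _ _ H ndH (rc _ cH)).
have cHG : continuous (H \- G) by move=> x; apply: cvgB; [exact: cH|exact: cG].
pose cuK : cumulative R R :=
  HB.pack (H \- G) (isCumulative.Build _ _ _ (H \- G) ndHG (rc _ cHG)).
pose mG := lebesgue_stieltjes_measure cuG.
pose mK := lebesgue_stieltjes_measure cuK.
have mE (f : cumulative R R) x y : x <= y ->
    lebesgue_stieltjes_measure f `]x, y] = (f y - f x)%:E.
  move=> xy; rewrite /lebesgue_stieltjes_measure/= /measure_extension/= measurable_mu_extE/=; last first.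
    by exact: is_ocitv.
  by rewrite wlength_itv_bnd.
have HE A : measurable A -> lebesgue_stieltjes_measure cuH A = nu A.
  apply: lebesgue_stieltjes_measure_unique => X /ocitvP[->|[[x y] /= xy ->]].
    by rewrite !measure0.
  by rewrite mE ?ltW// nuE// ltW.
have HE2 A : measurable A -> lebesgue_stieltjes_measure cuH A = measure_add mG mK A.
  apply: lebesgue_stieltjes_measure_unique => X /ocitvP[->|[[x y] /= xy ->]].
    by rewrite !measure0.
  rewrite mE ?ltW//; apply/esym; apply: (etrans (measure_addE mG mK _)).
  apply: (etrans (congr2 _ (mE cuG _ _ (ltW xy)) (mE cuK _ _ (ltW xy)))).
  by rewrite -EFinD; congr EFin => /=; lra.
have leGnu A : measurable A -> (mG A <= nu A)%E.
  by move=> mA; rewrite -HE// HE2// [leRHS](measure_addE mG mK) leeDl.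
have Goo : (mG setT < +oo)%E.
  apply: le_lt_trans (leGnu _ measurableT) _; rewrite /nu.
  have /integrableP[_] := ki; apply: le_lt_trans.
  rewrite le_eqVlt; apply/orP; left; apply/eqP; apply: eq_integral => x _ /=.
  by rewrite ger0_norm.
pose nG : {finite_measure set (measurableTypeR R) -> \bar R} :=
  mfrestr measurableT Goo.
have nGE A : nG A = mG A by rewrite /nG/= /mfrestr/= /mrestr setIT.
have dom : nG `<< (mu : {sigma_finite_measure set (measurableTypeR R) -> \bar R}).
  apply/null_content_dominatesP => A mA A0.
  apply/eqP; rewrite eq_le measure_ge0 andbT nGE.
  apply: le_trans (leGnu _ mA) _; rewrite /nu.
  rewrite null_set_integral//=.
  by apply: measurable_funS (measurable_int mu ki).
have [g [g0 gf ig gE]] := radon_nikodym_sigma_finite dom.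
exists (fine \o g); split.
  apply: eq_integrable ig => // x _ /=; by rewrite fineK.
move=> x y xy; rewrite /Rintegral.
have -> : (\int[mu]_(t in `]x, y]) ((fine \o g) t)%:E =
           \int[mu]_(t in `]x, y]) g t)%E.
  by apply: eq_integral => t _ /=; rewrite fineK.
rewrite -gE// nGE; have := congr1 fine (mE cuG _ _ xy).
by move=> /= <-.
Qed.

End monotone.

(** * Absolutely continuous functions *)
Section ac.
Context {R : realType}.
Notation mu := (@lebesgue_measure R).
Implicit Types (f g h : R -> R) (a b : R).

Lemma ae_imply (P Q : R -> Prop) : (forall x, P x -> Q x) ->
  {ae mu, forall x, P x} -> {ae mu, forall x, Q x}.
Proof. by move=> PQ; apply: filterS => //; exact: (ae_filter_ringOfSetsType mu). Qed.

Lemma ae_imply2 (P Q S : R -> Prop) : (forall x, P x -> Q x -> S x) ->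
  {ae mu, forall x, P x} -> {ae mu, forall x, Q x} -> {ae mu, forall x, S x}.
Proof. by move=> PQ; apply: filterS2 => //; exact: (ae_filter_ringOfSetsType mu). Qed.

(** Domination by the integral of one function, rather than the usual epsilon
and delta condition on families of intervals: it passes at once to functions
whose increments are controlled by those of others, and it is the form in
which the Radon-Nikodym theorem applies. *)
Definition ac_on f a b := exists h, [/\ mu.-integrable `[a, b] (EFin \o h),
  forall x, 0 <= h x &
  forall s t, a <= s -> s <= t -> t <= b ->
    `|f t - f s| <= \int[mu]_(x in `[s, t]) h x].

Lemma integrable_sub_itv h a b s t : a <= s -> t <= b ->
  mu.-integrable `[a, b] (EFin \o h) -> mu.-integrable `[s, t] (EFin \o h).
Proof.
move=> as_ tb; apply: integrableS => //.
by apply: subset_itv; rewrite bnd_simp.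
Qed.

Lemma Rintegral_cat h a b s t : a <= s -> s <= t -> t <= b ->
  mu.-integrable `[a, b] (EFin \o h) ->
  \int[mu]_(x in `[a, t]) h x =
  \int[mu]_(x in `[a, s]) h x + \int[mu]_(x in `[s, t]) h x.
Proof.
move=> as_ st tb ih.
have iat := integrable_sub_itv (lexx a) tb ih.
have := @Rintegral_itvB R h (BLeft a) (BRight t) s iat.
rewrite !bnd_simp => /(_ as_ st) E.
rewrite -(@Rintegral_itv_obnd_cbnd _ s (BRight t) h); last first.
  by apply: integrableS iat => //; apply: subset_itv; rewrite bnd_simp.
by rewrite -E; lra.
Qed.

Definition clamp a b (x : R) := Num.max a (Num.min x b).

Lemma clamp_itv a b x : a <= b -> clamp a b x \in `[a, b].
Proof. by move=> ab; rewrite in_itv/= le_max lexx/= ge_max ab ge_min lexx orbT. Qed.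

Lemma clamp_id a b x : a <= x <= b -> clamp a b x = x.
Proof. by move=> /andP[ax xb]; rewrite /clamp min_l// max_r. Qed.

Lemma clamp_homo a b : {homo clamp a b : x y / x <= y}.
Proof. by move=> x y xy; apply: le_max2 => //; exact: le_min2. Qed.

Lemma continuous_clamp a b : continuous (clamp a b).
Proof.
move=> x; apply: (@continuous_max _ _ (cst a) (Num.min^~ b)); first exact: cvg_cst.
by apply: (@continuous_min _ _ id (cst b)); [exact: cvg_id | exact: cvg_cst].
Qed.

Lemma continuous_comp_clamp f a b : a <= b -> {within `[a, b], continuous f} ->
  continuous (f \o clamp a b).
Proof.
move=> ab /subspace_continuousP cf x.
apply: (cvg_comp (clamp a b) f); last exact: (cf (clamp a b x) (clamp_itv _ ab)).
move=> A; rewrite /within/= => nA.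
have : \forall z \near x, `[a, b]%classic (clamp a b z) -> A (clamp a b z).
  exact: (@continuous_clamp a b x _ nA).
by apply: filterS => z /=; apply; exact: clamp_itv.
Qed.

(** With H the primitive of the dominating function, (H + f) / 2 is
nondecreasing with increments at most those of H, so it has a density g, and
f = 2 ((H + f) / 2) - H has density 2 g - h. The functions are made constant
outside [a, b] by clamping the variable. *)
Lemma ac_on_primitive f a b : a <= b -> ac_on f a b ->
  exists g, mu.-integrable `[a, b] (EFin \o g) /\
    forall s t, a <= s -> s <= t -> t <= b ->
      f t - f s = \int[mu]_(x in `[s, t]) g x.
Proof.
move=> ab [h [ih h0 fh]].
pose H x := \int[mu]_(y in `[a, clamp a b x]) h y.
have cH : continuous H.
  exact: (continuous_comp_clamp ab (parameterized_integral_continuous ab ih)).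
have HE x y : x <= y -> H y - H x = \int[mu]_(z in `[clamp a b x, clamp a b y]) h z.
  move=> xy; have := clamp_itv x ab; have := clamp_itv y ab.
  rewrite !in_itv/= => /andP[ay yb] /andP[ax xb].
  by rewrite /H (Rintegral_cat ax (clamp_homo a b xy) yb ih); lra.
have fH x y : x <= y -> `|f (clamp a b y) - f (clamp a b x)| <= H y - H x.
  move=> xy; rewrite HE//.
  have := clamp_itv x ab; have := clamp_itv y ab.
  rewrite !in_itv/= => /andP[ay yb] /andP[ax xb].
  by apply: fh => //; exact: clamp_homo.
pose fc := f \o clamp a b.
have cf : continuous fc.
  move=> x; apply/cvgrPdist_le => e e0.
  have /cvgrPdist_le/(_ _ e0) := cH x; apply: filterS => y; apply: le_trans.
  have [xy|/ltW yx] := leP x y.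
    rewrite distrC (distrC (H x)); apply: le_trans (fH _ _ xy) _; exact: ler_norm.
  apply: le_trans (fH _ _ yx) _; exact: ler_norm.
(* Halving makes the increments of G lie between 0 and those of H. *)
pose G x := 2^-1 * (H x + fc x).
have cG : continuous G.
  move=> x; apply: cvgM; first exact: cvg_cst.
  by apply: cvgD; [exact: cH|exact: cf].
have ndG : {homo G : x y / x <= y}.
  by move=> x y /fH; rewrite ler_norml /G /fc/= => /andP[]; lra.
have ndHG : {homo (H \- G) : x y / x <= y}.
  by move=> x y /fH; rewrite ler_norml /G /fc/= => /andP[]; lra.
pose k := h \_ `]a, b].
have k0 x : 0 <= k x by rewrite /k patchE; case: ifP.
have ioc : mu.-integrable `]a, b] (EFin \o h).
  by apply: integrableS ih => //; apply: subset_itv; rewrite bnd_simp.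
have ki : mu.-integrable setT (EFin \o k).
  by rewrite /k -restrict_EFin; apply/(integrable_mkcond _ _).1.
have kE (x y : R) : x <= y -> density_measure k `]x, y] = (H y - H x)%:E.
  move=> xy; rewrite HE// /density_measure.
  have := clamp_itv x ab; have := clamp_itv y ab.
  rewrite !in_itv/= => /andP[ay yb] /andP[ax xb].
  have i2 : mu.-integrable `]clamp a b x, clamp a b y] (EFin \o h).
    by apply: integrableS ih => //; apply: subset_itv; rewrite bnd_simp.
  rewrite -Rintegral_itv_obnd_cbnd// /Rintegral fineK; last first.
    exact: integrable_fin_num.
  transitivity (\int[mu]_(t in `]x, y]) ((EFin \o h) \_ `]a, b]) t)%E.
    by apply: eq_integral => z _; rewrite /k !patchE; case: ifP.
  rewrite -integral_mkcondr; congr (integral _ _ _).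
  apply/seteqP; split => z /=; rewrite !in_itv/= /clamp.
    move=> [/andP[xz zy] /andP[az zb]].
    by rewrite gt_max az gt_min xz/= le_max le_min zy zb orbT.
  rewrite gt_max gt_min le_max le_min => /andP[/andP[az xz] yz].
  have {yz} [zy zb] : z <= y /\ z <= b.
    by case/orP: yz => [za|/andP//]; move: (lt_le_trans az za); rewrite ltxx.
  have xz' : x < z by case/orP: xz => // bz; move: (lt_le_trans bz zb); rewrite ltxx.
  by rewrite xz' zy az zb.
have [g [ig gE]] := monotone_density k0 ki ndG cG cH ndHG kE.
have igab : mu.-integrable `[a, b] (EFin \o g) by exact: integrableS ig.
exists (fun x => 2 * g x - h x); split.
  rewrite [X in mu.-integrable _ X](_ : _ = (fun x => 2%:E * (EFin \o g) x - (EFin \o h) x)%E)//.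
  by apply: integrableB => //; exact: integrableZl.
move=> s t sa st tb.
have ig' := integrable_sub_itv sa tb igab.
have ih' := integrable_sub_itv sa tb ih.
rewrite RintegralB//=; last first.
  by rewrite [X in mu.-integrable _ X](_ : _ = (fun x => 2%:E * (EFin \o g) x)%E)//;
  exact: integrableZl.
rewrite RintegralZl// -Rintegral_itv_obnd_cbnd; last first.
  by apply: integrableS igab => //; apply: subset_itv; rewrite bnd_simp.
rewrite -gE//; have := HE _ _ st; rewrite !clamp_id ?sa ?(le_trans st)//; last first.
  by rewrite tb (le_trans sa).
by move=> <-; rewrite /G /fc /= !clamp_id ?sa ?(le_trans st)// ?tb ?(le_trans sa)//; lra.
Qed.

(** Up to a constant, f is on [a, b] the primitive of g extended by zero, to
which Lebesgue's differentiation theorem applies. *)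
Lemma primitive_derive f g a b :
  mu.-integrable `[a, b] (EFin \o g) ->
  (forall s t, a <= s -> s <= t -> t <= b ->
      f t - f s = \int[mu]_(x in `[s, t]) g x) ->
  {ae mu, forall x, a < x < b -> is_derive x 1 f (g x)}.
Proof.
move=> ig fE.
have lg := integrable_locally_restrict (measurable_itv `[a, b]) ig.
have := lebesgue_differentiation lg.
apply: ae_imply => x lx /andP[ax xb].
have ig2 : mu.-integrable `[a, b] (EFin \o (g \_ `[a, b])).
  apply: eq_integrable ig => // y; rewrite inE => yab /=.
  by rewrite patchE mem_set.
have := @FTC1_lebesgue_pt _ _ (BLeft a) x b xb ig2.
rewrite lte_fin => /(_ ax lx) [d1 d2].
have xab : x \in `[a, b]%classic by rewrite inE/= in_itv/= !ltW.
rewrite patchE xab in d2.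
have dF : is_derive x 1 (fun y => \int[mu]_(t in `[a, y]) (g \_ `[a, b]) t + f a) (g x).
  rewrite -[g x]addr0; apply: is_deriveD.
  by split; [exact: d1|rewrite -derive1E].
apply: near_eq_is_derive dF.
near=> y.
have yab : a <= y <= b.
  by apply/andP; split; apply: ltW; near: y; [exact: lt_nbhsr|exact: lt_nbhsl].
have [ay yb] := andP yab.
have := fE a y (lexx a) ay yb.
rewrite (_ : \int[mu]_(x in `[a, y]) g x = \int[mu]_(x in `[a, y]) (g \_ `[a, b]) x); first lra.
apply: eq_Rintegral => z; rewrite inE/= in_itv/= => /andP[az zy].
by rewrite patchE mem_set//= in_itv/= az (le_trans zy).
Unshelve. all: by end_near. Qed.

End ac.

Section ac_closure.
Context {R : realType}.
Notation mu := (@lebesgue_measure R).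
Implicit Types (f g h : R -> R) (a b : R).

Lemma ac_on_comb (I : finType) (F : I -> R -> R) (C : I -> R) f a b :
  (forall i, 0 <= C i) -> (forall i, ac_on (F i) a b) ->
  (forall s t, a <= s -> s <= t -> t <= b ->
    `|f t - f s| <= \sum_i C i * `|F i t - F i s|) -> ac_on f a b.
Proof.
move=> C0 /boolp.choice[h hE] fF.
have ih i : mu.-integrable `[a, b] (EFin \o h i) by case: (hE i).
have ihC i s t : a <= s -> t <= b -> mu.-integrable `[s, t] (EFin \o (fun x => C i * h i x)).
  move=> sa tb.
  rewrite [X in mu.-integrable _ X](_ : _ = (fun x => (C i)%:E * (EFin \o h i) x)%E)//.
  by apply: integrableZl => //; exact: integrable_sub_itv (ih i).
have isum s t (r : seq I) : a <= s -> t <= b ->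
    mu.-integrable `[s, t] (EFin \o (fun x => \sum_(i <- r) C i * h i x)).
  move=> sa tb.
  rewrite [X in mu.-integrable _ X](_ : _ =
     (fun x => \sum_(i <- r) (C i * h i x)%:E)%E); last first.
    by apply/funext => x /=; rewrite sumEFin.
  by apply: integrable_sum => // i _; exact: ihC.
exists (fun x => \sum_i C i * h i x); split.
- exact: isum.
- by move=> x; apply: sumr_ge0 => i _; rewrite mulr_ge0//; case: (hE i).
move=> s t sa st tb; apply: le_trans (fF _ _ sa st tb) _.
have -> : \int[mu]_(x in `[s, t]) (\sum_i C i * h i x) =
    \sum_i C i * \int[mu]_(x in `[s, t]) h i x.
  elim: (index_enum I) => [|i r IH].
    under eq_Rintegral do rewrite big_nil.
    by rewrite big_nil Rintegral_cst// mul0r.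
  under eq_Rintegral do rewrite big_cons.
  rewrite big_cons RintegralD//=; [|exact: ihC|exact: isum].
  by rewrite IH RintegralZl//; exact: integrable_sub_itv (ih i).
apply: ler_sum => i _; apply: ler_wpM2l => //.
by case: (hE i) => _ _; exact.
Qed.

Lemma ac_on_lipschitz f C a b : (forall s t, a <= s -> s <= t -> t <= b ->
    `|f t - f s| <= C * (t - s)) -> ac_on f a b.
Proof.
move=> fC; exists (fun=> `|C|); split => //.
  apply: continuous_compact_integrable; first exact: segment_compact.
  by apply: continuous_subspaceT => x; exact: cvg_cst.
move=> s t sa st tb; apply: le_trans (fC _ _ sa st tb) _.
rewrite Rintegral_cst//= lebesgue_measure_itv/= lte_fin.
move: st; rewrite le_eqVlt => /predU1P[->|st]; first by rewrite ltxx subrr/= !mulr0.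
by rewrite st/= ler_wpM2r ?ler_norm// subr_ge0 ltW.
Qed.

Lemma ac_on_comp1 f g C a b : 0 <= C -> ac_on g a b ->
  (forall s t, a <= s -> s <= t -> t <= b -> `|f t - f s| <= C * `|g t - g s|) ->
  ac_on f a b.
Proof.
move=> C0 ag fg; apply: (@ac_on_comb unit (fun=> g) (fun=> C)) => // s t sa st tb.
by rewrite big_const/= card_unit/= addr0; exact: fg.
Qed.

Lemma ac_on_comp2 f g1 g2 C1 C2 a b : 0 <= C1 -> 0 <= C2 ->
  ac_on g1 a b -> ac_on g2 a b ->
  (forall s t, a <= s -> s <= t -> t <= b ->
    `|f t - f s| <= C1 * `|g1 t - g1 s| + C2 * `|g2 t - g2 s|) ->
  ac_on f a b.
Proof.
move=> C10 C20 ag1 ag2 fg.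
apply: (@ac_on_comb bool (fun i => if i then g1 else g2) (fun i => if i then C1 else C2)).
- by case.
- by case.
- by move=> s t sa st tb; rewrite big_bool/=; exact: fg.
Qed.

Lemma ac_on_primitive_abs f g a b : mu.-integrable `[a, b] (EFin \o g) ->
  (forall s t, a <= s -> s <= t -> t <= b ->
      f t - f s = \int[mu]_(x in `[s, t]) g x) -> ac_on f a b.
Proof.
move=> ig fE; exists (fun x => `|g x|); split => //.
  exact: (integrable_norm ig).
move=> s t sa st tb; rewrite fE//; apply: le_normr_Rintegral => //.
exact: integrable_sub_itv ig.
Qed.

Lemma ac_on_ae_derivable f a b : a <= b -> ac_on f a b ->
  {ae mu, forall x, a < x < b -> derivable f x 1}.
Proof.
move=> ab /(ac_on_primitive ab)[g [ig fE]].
by apply: ae_imply (primitive_derive ig fE) => x H /H [].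
Qed.

Lemma ac_on_within f a b : a <= b -> ac_on f a b -> {within `[a, b], continuous f}.
Proof.
move=> ab af; have [g [ig fE]] := ac_on_primitive ab af.
have cP := parameterized_integral_continuous ab ig.
apply: (@subspace_eq_continuous R `[a, b]%classic R (fun x => \int[mu]_(t in `[a, x]) g t + f a) f).
  move=> x; rewrite inE/= in_itv/= => /andP[ax xb].
  by rewrite -(fE _ _ (lexx a) ax xb) subrK.
by move=> x; apply: cvgD; [exact: cP|exact: cvg_cst].
Qed.

Lemma ac_on_continuous f a b x : a < x < b -> ac_on f a b -> {for x, continuous f}.
Proof.
move=> /andP[ax xb] af; have ab := lt_trans ax xb.
have /(continuous_within_itvP _ ab)[+ _ _] := ac_on_within (ltW ab) af.
by apply; rewrite in_itv/= ax xb.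
Qed.

Lemma ac_on_clamp f a b a' b' : a <= b -> ac_on f a b ->
  ac_on (f \o clamp a b) a' b'.
Proof.
move=> ab [h [ih h0 fh]].
have i' (A : set R) : measurable A -> mu.-integrable A (EFin \o (h \_ `[a, b])).
  move=> mA; apply: (@integrableS _ _ _ _ setT) => //.
  by rewrite -restrict_EFin; apply/(integrable_mkcond _ _).1.
exists (h \_ `[a, b]); split => //.
- exact: i'.
- by move=> x; rewrite patchE; case: ifP.
move=> s t _ st _; have := clamp_itv s ab; have := clamp_itv t ab.
rewrite !in_itv/= => /andP[at_ tb] /andP[as_ sb].
have [E|csct] := eqVneq (clamp a b s) (clamp a b t).
  by rewrite E subrr normr0; apply: Rintegral_ge0 => x _; rewrite patchE; case: ifP.
have st' := clamp_homo a b st.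
apply: le_trans (fh _ _ as_ st' tb) _.
have -> : \int[mu]_(x in `[clamp a b s, clamp a b t]) h x =
          \int[mu]_(x in `[clamp a b s, clamp a b t]) (h \_ `[a, b]) x.
  apply: eq_Rintegral => x; rewrite inE/= in_itv/= => /andP[sx xt].
  by rewrite patchE mem_set//= in_itv/= (le_trans as_)// (le_trans xt).
rewrite /Rintegral fine_le//; try exact: integrable_fin_num (i' _ _).
apply: ge0_subset_integral => //=.
- by have /integrableP[] := i' _ (measurable_itv `[s, t]).
- by move=> x _; rewrite lee_fin patchE; case: ifP.
have {csct} : clamp a b s < clamp a b t by rewrite lt_neqAle csct.
move=> cst.
have ss : s <= clamp a b s.
  rewrite /clamp; have [sb'|bs] := leP s b; first by rewrite le_max lexx orbT.
  have := lt_le_trans cst tb; rewrite /clamp; rewrite (min_r (ltW bs)) max_r. by rewrite ltxx.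
  exact: ab.
have tt : clamp a b t <= t.
  have [ta|at'] := leP t a.
    have : clamp a b t <= a by rewrite /clamp ge_max lexx ge_min ta.
    by move=> /(lt_le_trans cst); rewrite ltNge as_.
  by rewrite /clamp ge_max (ltW at') ge_min lexx.
by apply: subset_itv; rewrite bnd_simp.
Qed.

(** On [a, c], f is the sum of its two clampings, up to a constant. *)
Lemma ac_on_glue f a b c : a <= b -> b <= c -> ac_on f a b -> ac_on f b c ->
  ac_on f a c.
Proof.
move=> ab bc af bf.
apply: (@ac_on_comp2 f _ _ 1 1 a c ler01 ler01 (ac_on_clamp a c ab af)
  (ac_on_clamp a c bc bf)) => s t as_ st tc; rewrite !mul1r.
have [sb|bs] := leP s b; have [tb|bt] := leP t b => /=.
- by rewrite !(@clamp_id _ a b) ?as_ ?(le_trans as_)// lerDl.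
- rewrite (@clamp_id _ a b s) ?as_// (@clamp_id _ b c t) ?(ltW bt)//.
  rewrite [clamp a b t]/clamp min_r ?(ltW bt)// max_r//.
  rewrite [clamp b c s]/clamp min_l ?(le_trans sb)// max_l//.
  rewrite -{1}(subrK (f b) (f t)) -addrA addrC; exact: ler_normD.
- by move: (lt_le_trans bs (le_trans st tb)); rewrite ltxx.
- by rewrite !(@clamp_id _ b c) ?(ltW bs) ?(ltW bt) ?(le_trans st)// lerDr.
Qed.

Lemma ac_on_mul f g C a b : (forall x, a <= x <= b -> `|f x| <= C) ->
  (forall x, a <= x <= b -> `|g x| <= C) -> ac_on f a b -> ac_on g a b ->
  ac_on (fun x => f x * g x) a b.
Proof.
move=> fC gC af ag.
have [ab|ba] := leP a b; last first.
  exists (fun=> 0); split => //; last by move=> s t as_ st tb;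
    move: (le_lt_trans (le_trans as_ (le_trans st tb)) ba); rewrite ltxx.
  by rewrite set_itv_ge ?bnd_simp -?ltNge//; exact: integrable_set0.
have C0 : 0 <= C by apply: le_trans (fC a _); rewrite ?lexx ?ab.
apply: (ac_on_comp2 C0 C0 af ag) => s t as_ st tb.
have -> : f t * g t - f s * g s = g t * (f t - f s) + f s * (g t - g s) by ring.
apply: le_trans (ler_normD _ _) _; rewrite !normrM; apply: lerD.
  by apply: ler_wpM2r => //; apply: gC; rewrite (le_trans as_).
by apply: ler_wpM2r => //; apply: fC; rewrite as_ (le_trans st).
Qed.

Lemma ac_on_bounded f a b : a <= b -> ac_on f a b ->
  exists C, forall x, a <= x <= b -> `|f x| <= C.
Proof.
move=> ab af; have cf := ac_on_within ab af.
have cN : {within `[a, b], continuous (fun x => `|f x|)}.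
  by move=> x; apply: cvg_norm; exact: cf.
have [c cab cM] := EVT_max ab cN.
by exists `|f c| => x xab; apply: cM; rewrite in_itv.
Qed.

Lemma ae_neq (c : R) : {ae mu, forall x : R, x != c}.
Proof.
exists [set c]; split => //; first by rewrite lebesgue_measure_set1.
by move=> x /= /negP; rewrite negbK => /eqP.
Qed.

Lemma ae_itv (P : R -> Prop) a b : {ae mu, forall x, a < x < b -> P x} ->
  {ae mu, forall x, `[a, b]%classic x -> P x}.
Proof.
move=> H; have H2 := ae_imply2 (fun x (h1 : x != a) (h2 : x != b) => conj h1 h2)
  (ae_neq a) (ae_neq b).
apply: ae_imply2 H H2 => x Hx [xa xb]; rewrite /= in_itv/= => /andP[ax bx].
by apply: Hx; rewrite lt_neqAle eq_sym xa ax lt_neqAle xb bx.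
Qed.

Lemma ae_eq_integrable f g (D : set R) : measurable D -> measurable_fun D g ->
  {ae mu, forall x, D x -> f x = g x} -> mu.-integrable D (EFin \o f) ->
  mu.-integrable D (EFin \o g) /\
  \int[mu]_(x in D) f x = \int[mu]_(x in D) g x.
Proof.
move=> mD mg fg /integrableP[mf foo].
have mg2 := (measurable_EFinP D g).2 mg.
split; last first.
  rewrite /Rintegral; congr fine; apply: ae_eq_integral => //.
  by apply: ae_imply fg => x /[apply] /= ->.
apply/integrableP; split => //; apply: le_lt_trans foo.
rewrite le_eqVlt; apply/orP; left; apply/eqP; apply: ae_eq_integral => //.
- exact: measurableT_comp.
- exact: measurableT_comp.
by apply: ae_imply fg => x /[apply] /= ->.
Qed.

Lemma ae_le_Rintegral f g (D : set R) : measurable D ->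
  mu.-integrable D (EFin \o f) -> mu.-integrable D (EFin \o g) ->
  {ae mu, forall x, D x -> f x <= g x} ->
  \int[mu]_(x in D) f x <= \int[mu]_(x in D) g x.
Proof.
move=> mD fi gi fg.
have mf : measurable_fun D f by apply/measurable_EFinP; case/integrableP : fi.
have mg : measurable_fun D g by apply/measurable_EFinP; case/integrableP : gi.
have mM : measurable_fun D (fun x => Num.max (f x) (g x)) by exact: measurable_maxr.
have gM : {ae mu, forall x, D x -> g x = Num.max (f x) (g x)}.
  by apply: (ae_imply _ fg) => x H Dx; rewrite max_r// H.
have [iM ->] := ae_eq_integrable mD mM gM gi.
by apply: le_Rintegral => // x _; rewrite le_max lexx.
Qed.

Lemma ac_on_FTC f d a b : a <= b -> ac_on f a b -> measurable_fun `[a, b] d ->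
  {ae mu, forall x, a < x < b -> is_derive x 1 f (d x)} ->
  mu.-integrable `[a, b] (EFin \o d) /\ f b - f a = \int[mu]_(x in `[a, b]) d x.
Proof.
move=> ab af md fd.
have [g [ig fE]] := ac_on_primitive ab af.
have gd : {ae mu, forall x, `[a, b]%classic x -> g x = d x}.
  apply: ae_itv; apply: ae_imply2 fd (primitive_derive ig fE) => x H1 H2 xab.
  by have [_ <-] := H1 xab; have [_ <-] := H2 xab.
by have [? <-] := ae_eq_integrable (measurable_itv _) md gd ig; rewrite fE.
Qed.

Lemma ac_on_le f e a b : a <= b -> ac_on f a b ->
  mu.-integrable `[a, b] (EFin \o e) ->
  {ae mu, forall x, a < x < b -> forall d, is_derive x 1 f d -> d <= e x} ->
  f b - f a <= \int[mu]_(x in `[a, b]) e x.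
Proof.
move=> ab af ie fe.
have [g [ig fE]] := ac_on_primitive ab af.
rewrite fE//; apply: ae_le_Rintegral => //; apply: ae_itv.
by apply: ae_imply2 fe (primitive_derive ig fE) => x H1 H2 xab; exact: H1 (H2 xab).
Qed.

(** The upper limit of the difference quotients along the steps 1 / (n + 1).
It is Borel measurable on the whole line when f is continuous, whereas the
value of the derivative is unspecified where f is not derivable. *)
Definition dquot f (x : R) : R :=
  fine (limn_esup (fun n : nat => (n.+1%:R * (f (x + n.+1%:R^-1) - f x))%:E)).

Lemma is_derive_dquot f (x d : R) : is_derive x 1 f d -> dquot f x = d.
Proof.
move=> [df <-]; rewrite /dquot.
have /cvg_ex[l /= fl] : derivable f x 1 by [].
have E : 'D_1 f x = l by apply/cvg_lim.
have hl := (cvgr_dnbhsP _ _ _).1 fl harmonic (conj (fun n => lt0r_neq0 (harmonic_gt0 n))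
  (@cvg_harmonic R)).
rewrite E.
pose u (n : nat) := (n.+1%:R * (f (x + n.+1%:R^-1) - f x))%:E.
have ul : u n @[n --> \oo] --> l%:E.
  apply: cvg_EFin; first exact: nearW.
  apply: cvg_trans hl; apply: near_eq_cvg; apply: nearW => n /=.
  rewrite /harmonic /= /GRing.scale/= invrK mulr1.
  by rewrite (addrC x).
by rewrite (is_cvg_limn_esupE (cvgP _ ul)) (cvg_lim _ ul).
Qed.

Lemma measurable_dquot f : continuous f -> measurable_fun setT (dquot f).
Proof.
move=> cf.
have mf (g : R -> R) : continuous g -> measurable_fun setT g.
  by move=> cg; apply: open_continuous_measurable_fun; [exact: openT|move=> x _; exact: cg].
apply: (measurableT_comp (fine_measurable measurableT)).
apply: measurable_fun_limn_esup => n; apply/measurable_EFinP.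
apply: measurable_funM => //; apply: measurable_funB; last exact: mf.
apply: (mf (f \o (fun y => y + n.+1%:R^-1))) => x.
apply: continuous_comp; last exact: cf.
by apply: cvgD; [exact: cvg_id|exact: cvg_cst].
Qed.

End ac_closure.

Section ac_lattice.
Context {R : realType}.
Implicit Types (f g : R -> R).

Lemma ler_dist_max (a b c d : R) : `|Num.max a b - Num.max c d| <= `|a - c| + `|b - d|.
Proof.
have := ler_norm (a - c); have := ler_norm (c - a); rewrite (distrC c).
have := ler_norm (b - d); have := ler_norm (d - b); rewrite (distrC d).
rewrite ler_norml; case: (leP a b) => ab; case: (leP c d) => cd; lra.
Qed.

Lemma ac_on_max f g a b : ac_on f a b -> ac_on g a b ->
  ac_on (fun t => Num.max (f t) (g t)) a b.
Proof.
move=> af ag; apply: (ac_on_comp2 ler01 ler01 af ag) => s t _ _ _.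
by rewrite !mul1r; exact: ler_dist_max.
Qed.

Lemma ac_on_opp f a b : ac_on f a b -> ac_on (fun t => - f t) a b.
Proof.
move=> af; apply: (ac_on_comp1 ler01 af) => s t _ _ _.
by rewrite mul1r -opprD normrN.
Qed.

Lemma ac_on_min f g a b : ac_on f a b -> ac_on g a b ->
  ac_on (fun t => Num.min (f t) (g t)) a b.
Proof.
move=> af ag; rewrite (_ : (fun t => _) = (fun t => - Num.max (- f t) (- g t))).
  by apply: ac_on_opp; apply: ac_on_max; exact: ac_on_opp.
by apply/funext => t; rewrite oppr_max !opprK.
Qed.

Lemma ac_on_sub2 f g a b : ac_on f a b -> ac_on g a b -> ac_on (fun t => f t - g t) a b.
Proof.
move=> af ag; apply: (ac_on_comp2 ler01 ler01 af ag) => s t _ _ _.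
rewrite !mul1r (_ : _ - _ = (f t - f s) - (g t - g s)); last ring.
exact: ler_normB.
Qed.

Lemma ac_on_derivable f (df : R -> R) C a b :
  (forall s : R, a <= s <= b -> is_derive s 1 f (df s)) ->
  (forall s, a <= s <= b -> `|df s| <= C) -> ac_on f a b.
Proof.
move=> fd dC; apply: (@ac_on_lipschitz _ _ C) => s t as_ st tb.
have sub x : s <= x <= t -> a <= x <= b.
  by move=> /andP[sx xt]; rewrite (le_trans as_)// (le_trans xt).
have fd' x : x \in `]s, t[ -> is_derive x 1 f (df x).
  by rewrite in_itv/= => /andP[sx xt]; apply: fd; apply: sub; rewrite !ltW.
have cf : {within `[s, t], continuous f}.
  apply: derivable_within_continuous => x; rewrite in_itv/= => /sub xab.
  exact: isD_derivable (fd x xab).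
have [x] := MVT_segment st fd' cf; rewrite in_itv/= => /sub xab ->.
by rewrite normrM [`|t - s|]ger0_norm ?subr_ge0// ler_wpM2r ?subr_ge0// dC.
Qed.

End ac_lattice.

(** * Smooth functions with compact support *)
Section bump.
Context {R : realType}.
Implicit Types (f g : R -> R).

(** The functions x^(- n) exp(- 1 / x), extended by zero to x <= 0: they are
infinitely flat at 0, and the derivative of one is a combination of two
others. *)
Definition flat (n : nat) (x : R) : R :=
  if 0 < x then x^-1 ^+ n * expR (- x^-1) else 0.

Lemma flat_le0 n x : x <= 0 -> flat n x = 0.
Proof. by rewrite /flat leNgt => /negbTE ->. Qed.

Lemma flat_gt0 n x : 0 < x -> 0 < flat n x.
Proof. by move=> x0; rewrite /flat x0 mulr_gt0// ?expR_gt0// exprn_gt0// invr_gt0. Qed.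

Lemma flat_ge0 n x : 0 <= flat n x.
Proof. by have [/flat_le0 -> //|/(flat_gt0 n)/ltW] := leP x 0. Qed.

(** From exp y >= y^(n + 2) / (n + 2)! at y = 1 / x. *)
Lemma flat_quadratic n x : `|flat n x| <= n.+2`!%:R * x ^+ 2.
Proof.
have [x0|x0] := leP x 0; first by rewrite flat_le0// normr0 mulr_ge0// sqr_ge0.
rewrite ger0_norm ?flat_ge0// /flat x0.
have y0 : 0 < x^-1 by rewrite invr_gt0.
have H := @expR_ge1Dxn R x^-1 n.+1 (ltW y0).
have f0 : (0:R) < n.+2`!%:R by rewrite ltr0n fact_gt0.
have {}H : x^-1 ^+ n.+2 <= n.+2`!%:R * expR x^-1.
  by rewrite mulrC -ler_pdivrMr//; apply: le_trans H; rewrite lerDr.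
rewrite expRN ler_pdivrMr ?expR_gt0//.
have -> : x^-1 ^+ n = x^-1 ^+ n.+2 * x ^+ 2.
  by rewrite -addn2 exprD -mulrA -exprMn mulVf ?gt_eqF// expr1n mulr1.
rewrite [leRHS]mulrAC; apply: ler_wpM2r => //; exact: sqr_ge0.
Qed.

Lemma isD_flat n (x : R) :
  is_derive x 1 (flat n) (flat n.+2 x - n%:R * flat n.+1 x).
Proof.
have [x0|x0|->] := ltgtP x 0.
- rewrite !flat_le0 ?ltW// mulr0 subr0.
  apply: isD_near (isD_cst 0 x); near=> t; rewrite flat_le0//; apply/ltW.
  by near: t; exact: lt_nbhsl.
- apply: (@isD_near _ (fun t => t^-1 ^+ n * expR (- t^-1))).
    near=> t; rewrite /flat ifT//; near: t; exact: lt_nbhsr.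
  have iv := isD_inv (lt0r_neq0 x0) (isD_id x).
  have ex := @isD_comp _ expR (fun t => - t^-1) x _ _ (is_derive_expR (- x^-1)) (isD_opp iv).
  have pw : is_derive x 1 (fun t : R => t^-1 ^+ n) (n%:R * x^-1 ^+ n.-1 * (- x ^- 2 * 1)).
    exact: isD_exp iv.
  apply: isD_eq (isD_mul pw ex) _; rewrite /flat x0.
  case: n pw => [|n] _.
    by rewrite !mul0r !mulr0 addr0 subr0 expr0; field; rewrite gt_eqF.
  rewrite /= !exprS; field; rewrite gt_eqF//.
rewrite !flat_le0// mulr0 subr0; apply: (@isD_quadratic _ _ _ n.+2`!%:R).
near=> s; rewrite addr0 (@flat_le0 _ 0)// subr0; exact: flat_quadratic.
Unshelve. all: by end_near. Qed.

(** A space of functions that contains bumps on every interval and is stable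
under differentiation; this gives derivatives of all orders at once. *)
Inductive flat_alg : (R -> R) -> Prop :=
| flat_base (a b : R) m n : flat_alg (fun t => flat m (t - a) * flat n (b - t))
| flat_add f g : flat_alg f -> flat_alg g -> flat_alg (fun t => f t + g t)
| flat_scale c f : flat_alg f -> flat_alg (fun t => c * f t).

Lemma flat_alg_derive f : flat_alg f ->
  (forall x : R, derivable f x 1) /\ flat_alg (derive1 f).
Proof.
have P1 (u g : R -> R) : (forall x : R, is_derive x 1 u (g x)) -> flat_alg g ->
    (forall x : R, derivable u x 1) /\ flat_alg (derive1 u).
  move=> fg ag; split=> [x|]; first exact: isD_derivable (fg x).
  by rewrite (_ : derive1 u = g)//; apply/funext => x; rewrite derive1E; case: (fg x).
elim=> [a b m n|{}f g _ [df af] _ [dg ag]|c {}f _ [df af]]; last first.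
- apply: P1 (flat_scale c af) => x; exact/isD_scale/isD_derive1.
- by apply: P1 (flat_add af ag) => x; apply: isD_add; exact: isD_derive1.
have d1 (x : R) : is_derive x 1 (fun t : R => t - a) 1.
  by apply: isD_eq (isD_sub (isD_id x) (isD_cst a x)) _; rewrite subr0.
have d2 (x : R) : is_derive x 1 (fun t : R => b - t) (- 1).
  by apply: isD_eq (isD_sub (isD_cst b x) (isD_id x)) _; rewrite sub0r.
have H x := isD_mul (@isD_comp _ (flat m) (fun t => t - a) x _ _ (isD_flat m (x - a)) (d1 x))
  (@isD_comp _ (flat n) (fun t => b - t) x _ _ (isD_flat n (b - x)) (d2 x)).
apply: (P1 _ (fun x =>
  (-1 * (flat m (x - a) * flat n.+2 (b - x)) + n%:R * (flat m (x - a) * flat n.+1 (b - x)))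
  + (flat m.+2 (x - a) * flat n (b - x) + (- m%:R) * (flat m.+1 (x - a) * flat n (b - x))))).
  by move=> x; apply: isD_eq (H x) _; ring.
by apply: flat_add; apply: flat_add; try apply: flat_scale; exact: flat_base.
Qed.

Lemma flat_alg_smooth f : flat_alg f -> forall k (x : R), derivable (derive1n k f) x 1.
Proof.
move=> ff k; suff : flat_alg (derive1n k f) by move=> /flat_alg_derive[].
by elim: k => // k IH; rewrite derive1nS; case: (flat_alg_derive IH).
Qed.

Definition bump (c d t : R) : R :=
  flat 0 (t - (c - d)) * flat 0 ((c + d) - t).

Lemma bump_alg c d : flat_alg (bump c d).
Proof. exact: flat_base. Qed.

Lemma bump_ge0 c d t : 0 <= bump c d t.
Proof. by rewrite /bump mulr_ge0// flat_ge0. Qed.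

Lemma bump_gt0 c d t : `|t - c| < d -> 0 < bump c d t.
Proof.
by rewrite ltr_norml => /andP[h1 h2]; rewrite /bump mulr_gt0// flat_gt0//; lra.
Qed.

Lemma bump_eq0 c d t : d <= `|t - c| -> bump c d t = 0.
Proof.
rewrite ler_normr => /orP[h|h]; rewrite /bump.
  by rewrite (@flat_le0 _ (c + d - t)) ?mulr0//; lra.
by rewrite (@flat_le0 _ (t - (c - d))) ?mul0r//; lra.
Qed.

Lemma flat_alg_continuous f : flat_alg f -> continuous f.
Proof. by move=> /flat_alg_derive[df _] x; exact: isD_continuous (isD_derive1 (df x)). Qed.

End bump.

(** * Weak derivatives *)
Section weak.
Context {R : realType}.
Notation mu := (@lebesgue_measure R).
Implicit Types (f g k phi : R -> R) (a b c x M : R).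

Lemma continuous_itv_integrable f a b : continuous f ->
  mu.-integrable `[a, b] (EFin \o f).
Proof.
move=> cf; apply: continuous_compact_integrable; first exact: segment_compact.
exact: continuous_subspaceT.
Qed.

Lemma isD_prim k a x : continuous k -> a < x ->
  is_derive x 1 (fun y => \int[mu]_(t in `[a, y]) k t) (k x).
Proof.
move=> ck ax.
have x1 : x < x + 1 by rewrite ltrDl.
have [d1 d2] := continuous_FTC1_closed x1 (continuous_itv_integrable a (x + 1) ck) ax (ck x).
by apply: DeriveDef; [exact: d1|rewrite -derive1E; exact: d2].
Qed.

Lemma bump_int_gt0 a b c d : 0 < d -> a <= c - d -> c + d <= b ->
  0 < \int[mu]_(t in `[a, b]) bump c d t.
Proof.
move=> d0 ac cb.
have cB := flat_alg_continuous (bump_alg c d).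
have iB x y := continuous_itv_integrable x y cB.
have d2 : 0 < d / 2 by rewrite divr_gt0.
have lt2 : d / 2 < d by rewrite ltr_pdivrMr// ltr_pMr// ltr1n.
have h1 : a <= c - d / 2 by lra.
have h2 : c - d / 2 <= c + d / 2 by lra.
have h3 : c + d / 2 <= b by lra.
rewrite (Rintegral_cat (le_trans h1 h2) h3 (lexx b) (iB a b)).
rewrite (Rintegral_cat h1 h2 h3 (iB a b)).
have p x y : 0 <= \int[mu]_(t in `[x, y]) bump c d t.
  by apply: Rintegral_ge0 => t _; exact: bump_ge0.
rewrite ltr_pwDl// ltr_wpDl//.
have [m] := EVT_min h2 (continuous_subspaceT cB).
rewrite in_itv/= => /andP[m1 m2] mP.
have m0 : 0 < bump c d m by apply: bump_gt0; rewrite ltr_norml; lra.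
apply: (@lt_le_trans _ _ (\int[mu]_(t in `[c - d / 2, c + d / 2]) bump c d m)).
  rewrite Rintegral_cst//= lebesgue_measure_itv/= lte_fin ifT; last lra.
  by rewrite -EFinB/= mulr_gt0//; lra.
apply: le_Rintegral => //.
by apply: continuous_itv_integrable => x; exact: cvg_cst.
Qed.

Lemma Rintegral_support f a b : (forall x, ~~ (a <= x <= b) -> f x = 0) ->
  \int[mu]_x f x = \int[mu]_(x in `[a, b]) f x.
Proof.
move=> f0; rewrite [RHS]Rintegral_mkcond; congr Rintegral; apply/funext => x.
rewrite patchE; case: ifPn => //; rewrite notin_setE/= in_itv/= => /negP.
exact: f0.
Qed.

Lemma test_function_derive0 phi M : (forall x, M < `|x| -> phi x = 0) ->
  forall x, M < `|x| -> derive1 phi x = 0.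
Proof.
move=> H x Mx; have : is_derive x 1 phi 0.
  apply: isD_near (isD_cst 0 x); near=> y; rewrite H//.
  near: y; have e0 : 0 < `|x| - M by rewrite subr_gt0.
  apply: filterS (nbhsx_ballx x _ e0) => y; rewrite /ball/= => xy.
  by have := lerB_dist x y; lra.
by rewrite derive1E; case.
Unshelve. all: by end_near. Qed.

Lemma ac_on_C1 f a b : (forall x, derivable f x 1) -> continuous (derive1 f) ->
  ac_on f a b.
Proof.
move=> df cf.
have [ab|ba] := leP a b; last first.
  by apply: (@ac_on_lipschitz _ _ 0) => s t as_ st tb;
    move: (le_lt_trans (le_trans as_ (le_trans st tb)) ba); rewrite ltxx.
have cN : {within `[a, b], continuous (fun x => `|derive1 f x|)}.
  by apply: continuous_subspaceT => x; apply: cvg_norm; exact: cf.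
have [c cab cM] := EVT_max ab cN.
apply: (@ac_on_derivable R f (derive1 f) `|derive1 f c| a b) => x xab.
  exact: isD_derive1.
by apply: cM; rewrite in_itv.
Qed.

Lemma derivable1_continuous f : (forall x, derivable f x 1) -> continuous f.
Proof. by move=> df x; exact: isD_continuous (isD_derive1 (df x)). Qed.

Lemma test_function_ac phi a b : test_function phi -> ac_on phi a b.
Proof.
move=> [dphi _]; apply: ac_on_C1; first exact: (dphi 0%N).
exact: derivable1_continuous (dphi 1%N).
Qed.

(** The product f phi is absolutely continuous and vanishes at both ends. *)
Lemma ac_parts f (d : R -> R) phi a b : a < b -> ac_on f a b -> measurable_fun `[a, b] d ->
  {ae mu, forall x, a < x < b -> is_derive x 1 f (d x)} ->
  test_function phi -> phi a = 0 -> phi b = 0 ->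
  [/\ mu.-integrable `[a, b] (EFin \o (fun x => f x * derive1 phi x)),
     mu.-integrable `[a, b] (EFin \o (fun x => d x * phi x)) &
  \int[mu]_(x in `[a, b]) (f x * derive1 phi x) =
    - \int[mu]_(x in `[a, b]) (d x * phi x)].
Proof.
move=> ab af md fd tphi pa pb.
have ap := test_function_ac a b tphi.
have [dphi _] := tphi.
have cp : continuous phi by exact: derivable1_continuous (dphi 0%N).
have cp' : continuous (derive1 phi) by exact: derivable1_continuous (dphi 1%N).
have [C1 fC] := ac_on_bounded (ltW ab) af.
have [C2 pC] := ac_on_bounded (ltW ab) ap.
have afp : ac_on (fun x => f x * phi x) a b.
  apply: (@ac_on_mul _ _ _ (Num.max C1 C2)) => // x xab.
    by rewrite le_max fC.
  by rewrite le_max pC// orbT.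
have ifp : mu.-integrable `[a, b] (EFin \o (fun x => f x * derive1 phi x)).
  apply: continuous_compact_integrable; first exact: segment_compact.
  move=> x; apply: cvgM; first exact: (ac_on_within (ltW ab) af).
  exact: (continuous_subspaceT cp').
have mfp : measurable_fun `[a, b] (fun x => f x * derive1 phi x).
  by apply/measurable_EFinP; case/integrableP : ifp.
have mdp : measurable_fun `[a, b] (fun x => d x * phi x).
  apply: measurable_funM => //.
  by apply: measurable_funTS; exact: continuous_measurable_fun.
have [] := @ac_on_FTC _ (fun x => f x * phi x)
    (fun x => f x * derive1 phi x + d x * phi x) a b (ltW ab) afp.
- exact: measurable_funD.
- apply: ae_imply fd => x /[apply] fx.
  by apply: isD_eq (isD_mul fx (isD_derive1 (dphi 0%N x))) _; rewrite (mulrC (d x)).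
move=> isum; rewrite pa pb !mulr0 subrr => E.
have idp : mu.-integrable `[a, b] (EFin \o (fun x => d x * phi x)).
  rewrite [X in mu.-integrable _ X](_ : _ = (fun x =>
    (EFin \o (fun x => f x * derive1 phi x + d x * phi x)%R) x -
    (EFin \o (fun x => f x * derive1 phi x)%R) x)%E).
    exact: integrableB.
  by apply/funext => x /=; rewrite -EFinB; congr EFin; ring.
split => //; apply/eqP; rewrite -subr_eq0 opprK -RintegralD//; exact/eqP.
Qed.

Lemma ac_weak_derivative f (d : R -> R) : (forall a b, a <= b -> ac_on f a b) ->
  measurable_fun setT d -> {ae mu, forall x, is_derive x 1 f (d x)} ->
  forall phi, test_function phi ->
  \int[mu]_x (f x * derive1 phi x) = - \int[mu]_x (d x * phi x).
Proof.
move=> af md fd phi tphi; have [dphi [M pM]] := tphi.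
pose N := `|M| + 1.
have N0 : 0 < N by rewrite ltr_wpDl.
have MN : M < N by rewrite (le_lt_trans (ler_norm _))// ltrDl.
have out x : ~~ (- N <= x <= N) -> M < `|x|.
  by move=> h; apply: (lt_trans MN); rewrite ltNge ler_norml.
have nN : - N < N by lra.
have p1 : phi (- N) = 0 by apply: pM; rewrite normrN gtr0_norm.
have p2 : phi N = 0 by apply: pM; rewrite gtr0_norm.
have [_ _ E] := ac_parts nN (af _ _ (ltW nN)) (measurable_funTS md)
  (ae_imply (fun x h _ => h) fd) tphi p1 p2.
rewrite (@Rintegral_support _ (- N) N); last first.
  by move=> x /out /(test_function_derive0 pM) ->; rewrite mulr0.
rewrite (@Rintegral_support (fun x => d x * phi x) (- N) N)//.
by move=> x /out /pM ->; rewrite mulr0.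
Qed.

End weak.

Section dubois.
Context {R : realType}.
Notation mu := (@lebesgue_measure R).

Lemma locally_integrable_itv (g : R -> R) (a b : R) :
  locally_integrable setT g -> mu.-integrable `[a, b] (EFin \o g).
Proof.
move=> [mg _ ig]; apply/integrableP; split.
  by apply/measurable_EFinP; exact: measurable_funTS.
by apply: ig => //; exact: segment_compact.
Qed.

(** The primitive of k is a test function, and not only k: it vanishes beyond
b because k has integral zero. *)
Lemma prim_test (k : R -> R) (a b : R) : a < b -> flat_alg k ->
  (forall x, ~~ (a < x < b) -> k x = 0) -> \int[mu]_(t in `[a, b]) k t = 0 ->
  exists phi, [/\ test_function phi, derive1 phi = k & forall x, ~~ (a < x < b) -> phi x = 0].
Proof.
move=> ab ak k0 ik.
have ck := flat_alg_continuous ak.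
have int0 x y : (y <= a) || (b <= x) -> \int[mu]_(t in `[x, y]) k t = 0.
  move=> h; rewrite (@eq_Rintegral _ _ _ mu `[x, y]%classic (fun=> 0)).
    by rewrite Rintegral_cst// mul0r.
  move=> t.
  rewrite inE/= in_itv/= => /andP[xt ty]; apply: k0; rewrite negb_and -!leNgt.
  by case/orP: h => h; rewrite ?(le_trans ty h)// (le_trans h xt) orbT.
pose phi x := \int[mu]_(t in `[a - 1, x]) k t.
have phi0 x : ~~ (a < x < b) -> phi x = 0.
  rewrite negb_and -!leNgt => /orP[xa|bx]; rewrite /phi; first by rewrite int0// xa.
  have iB := continuous_itv_integrable (a - 1) x ck.
  have h1 : a - 1 <= a by rewrite gerBl.
  rewrite (Rintegral_cat h1 (le_trans (ltW ab) bx) (lexx x) iB) (int0 (a - 1) a) ?lexx// add0r.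
  have iB' := continuous_itv_integrable a x ck.
  by rewrite (Rintegral_cat (ltW ab) bx (lexx x) iB') ik add0r int0// lexx orbT.
have dphi (x : R) : is_derive x 1 phi (k x).
  have [h|h] := ltP (a - 1) x; first exact: isD_prim.
  have xa : x < a by rewrite (le_lt_trans h)// gtrBl.
  rewrite k0 ?negb_and -?leNgt ?(ltW xa)//; apply: isD_near (isD_cst 0 x).
  near=> y; rewrite phi0// negb_and -leNgt; apply/orP; left; apply: ltW.
  by near: y; exact: lt_nbhsl.
have d1 : derive1 phi = k by apply/funext => x; rewrite derive1E; case: (dphi x).
exists phi; split => //; split.
  case=> [|j] x; first exact: isD_derivable (dphi x).
  by rewrite /derive1n iterSr d1; exact: flat_alg_smooth.
exists (Num.max `|a| `|b|) => x; rewrite gt_max => /andP[xa xb].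
apply: phi0; apply/negP => /andP[ax bx].
have [x0|x0] := leP 0 x.
  by move: xb; rewrite (ger0_norm x0) => xb; have := ler_norm b; lra.
by move: xa; rewrite (ltr0_norm x0) => xa; have := ler_norm (- a); rewrite normrN; lra.
Unshelve. all: by end_near. Qed.

Lemma bump_average (u : R -> R) (a b c d e : R) : {within `[a, b], continuous u} ->
  0 < d -> a <= c - d -> c + d <= b ->
  (forall x, `|x - c| < d -> `|u x - u c| <= e) ->
  `|(\int[mu]_(t in `[a, b]) bump c d t)^-1 * \int[mu]_(t in `[a, b]) (u t * bump c d t) - u c| <= e.
Proof.
move=> cu d0 ac cb ue.
have I0 := bump_int_gt0 d0 ac cb.
set I := \int[mu]_(t in _) bump c d t in I0 *.
have cB := flat_alg_continuous (bump_alg c d).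
have iB := continuous_itv_integrable a b cB.
have iuB : mu.-integrable `[a, b] (EFin \o (fun t => u t * bump c d t)).
  apply: continuous_compact_integrable; first exact: segment_compact.
  by move=> x; apply: cvgM; [exact: cu|exact: (continuous_subspaceT cB)].
have iZ r : mu.-integrable `[a, b] (EFin \o (fun t => r * bump c d t)).
  by rewrite [X in mu.-integrable _ X](_ : _ = (fun x => r%:E * (EFin \o bump c d) x)%E)//;
  exact: integrableZl.
have bnd t : (u c - e) * bump c d t <= u t * bump c d t <= (u c + e) * bump c d t.
  have [tc|tc] := ltP `|t - c| d; last by rewrite bump_eq0// !mulr0 lexx.
  have := ue _ tc; rewrite ler_norml => /andP[h1 h2].
  by rewrite !ler_pM2r ?bump_gt0//; lra.
have lo : (u c - e) * I <= \int[mu]_(t in `[a, b]) (u t * bump c d t).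
  by rewrite -RintegralZl//; apply: le_Rintegral => // t _; case/andP: (bnd t).
have hi : \int[mu]_(t in `[a, b]) (u t * bump c d t) <= (u c + e) * I.
  by rewrite -RintegralZl//; apply: le_Rintegral => // t _; case/andP: (bnd t).
set J := \int[mu]_(t in _) _ in lo hi *.
have {}lo : u c - e <= I^-1 * J by rewrite mulrC ler_pdivlMr.
have {}hi : I^-1 * J <= u c + e by rewrite mulrC ler_pdivrMr.
by rewrite ler_norml; lra.
Qed.

(** The lemma of du Bois-Reymond. Let F be a primitive of g and u = f - F. By
parts, u is orthogonal to every k that is the derivative of a test function,
in particular to the difference of two normalized bumps at s and at t. The
averages of u against these bumps are therefore equal; by continuity of u they
are as close as desired to u s and u t. *)
Lemma weak_derivative_primitive (f g : R -> R) : continuous f ->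
  locally_integrable setT g ->
  (forall phi, test_function phi ->
    \int[mu]_x (f x * derive1 phi x) = - \int[mu]_x (g x * phi x)) ->
  forall s t, s <= t -> f t - f s = \int[mu]_(x in `[s, t]) g x.
Proof.
move=> cf lg fg s t; rewrite le_eqVlt => /predU1P[->|st].
  by rewrite subrr set_itv1 Rintegral_set1.
pose a := s - 1; pose b := t + 1.
have ab : a < b by rewrite /a /b; lra.
have ig := locally_integrable_itv a b lg.
have mg : measurable_fun `[a, b] g by apply: measurable_funTS; case: lg.
pose F x := \int[mu]_(y in `[a, x]) g y.
have FE x y : a <= x -> x <= y -> y <= b -> F y - F x = \int[mu]_(z in `[x, y]) g z.
  by move=> ax xy yb; rewrite /F (Rintegral_cat ax xy yb ig); lra.
have aF := ac_on_primitive_abs ig FE.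
have dF := primitive_derive ig FE.
have cF := ac_on_within (ltW ab) aF.
pose u x := f x - F x.
have cu : {within `[a, b], continuous u}.
  by move=> x; apply: cvgB; [exact: (continuous_subspaceT cf)|exact: cF].
suff : u t = u s by rewrite -FE /u ?/a ?/b; lra.
have ne0 e : 0 < e -> `|u t - u s| <= 2 * e.
  move=> e0.
  have uct c : a < c < b -> exists d, [/\ 0 < d, d < 1 & forall x, `|x - c| < d -> `|u x - u c| <= e].
    move=> cab; have cuc : {for c, continuous u}.
      by move/(continuous_within_itvP _ ab): cu => [+ _ _]; apply; rewrite in_itv.
    have [d /= d0 dP] := (cvgrPdist_le _ _).1 cuc e e0.
    exists (Num.min d (1/2)); split.
    - by rewrite lt_min d0/=; lra.
    - by rewrite gt_min; apply/orP; right; lra.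
    - by move=> x; rewrite lt_min => /andP[xd _]; rewrite distrC; apply: dP; rewrite /= distrC.
  have [|d1 [d10 d11 d1P]] := uct s; first by rewrite /a /b; lra.
  have [|d2 [d20 d21 d2P]] := uct t; first by rewrite /a /b; lra.
  have as1 : a <= s - d1 by rewrite /a; lra.
  have sb1 : s + d1 <= b by rewrite /b; lra.
  have as2 : a <= t - d2 by rewrite /a; lra.
  have sb2 : t + d2 <= b by rewrite /b; lra.
  have H1 := bump_average cu d10 as1 sb1 d1P.
  have H2 := bump_average cu d20 as2 sb2 d2P.
  have I1p := bump_int_gt0 d10 as1 sb1; have I2p := bump_int_gt0 d20 as2 sb2.
  set I1 := \int[mu]_(x in `[a, b]) bump s d1 x in H1 I1p.
  set I2 := \int[mu]_(x in `[a, b]) bump t d2 x in H2 I2p.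
  pose k x := I1^-1 * bump s d1 x + (- I2^-1) * bump t d2 x.
  have ak : flat_alg k by apply: flat_add; apply: flat_scale; exact: bump_alg.
  have k0 x : ~~ (a < x < b) -> k x = 0.
    rewrite /a /b negb_and -!leNgt => /orP xab.
    rewrite /k !bump_eq0 ?mulr0 ?addr0// ler_normr; apply/orP.
      by case: xab => h; [right|left]; lra.
    by case: xab => h; [right|left]; lra.
  have iB1 := continuous_itv_integrable a b (flat_alg_continuous (bump_alg s d1)).
  have iB2 := continuous_itv_integrable a b (flat_alg_continuous (bump_alg t d2)).
  have iZ (h : R -> R) r : mu.-integrable `[a, b] (EFin \o h) ->
      mu.-integrable `[a, b] (EFin \o (fun t => r * h t)).
    move=> ih; rewrite [X in mu.-integrable _ X](_ : _ = (fun x => r%:E * (EFin \o h) x)%E)//.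
    exact: integrableZl.
  have ik : \int[mu]_(x in `[a, b]) k x = 0.
    rewrite /k RintegralD//; try exact: iZ.
    by rewrite !RintegralZl// -/I1 -/I2 mulNr !mulVf ?gt_eqF// subrr.
  have [phi [tphi dphi phi0]] := prim_test ab ak k0 ik.
  have pa : phi a = 0 by apply: phi0; rewrite ltxx.
  have pb : phi b = 0 by apply: phi0; rewrite ltxx andbF.
  have [iFk igp E] := ac_parts ab aF mg dF tphi pa pb.
  have := fg _ tphi.
  rewrite (@Rintegral_support _ _ a b); last first.
    move=> x xab; rewrite dphi k0 ?mulr0//; apply: contra xab => /andP[ax xb].
    by rewrite !ltW.
  rewrite (@Rintegral_support _ (fun x => g x * phi x) a b); last first.
    move=> x xab; rewrite phi0 ?mulr0//; apply: contra xab => /andP[ax xb].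
    by rewrite !ltW.
  rewrite -E dphi => fF; rewrite dphi in iFk.
  have ck := flat_alg_continuous ak.
  have ifk : mu.-integrable `[a, b] (EFin \o (fun x => f x * k x)).
    by apply: continuous_itv_integrable => x; apply: cvgM; [exact: cf|exact: ck].
  have uk0 : \int[mu]_(x in `[a, b]) (u x * k x) = 0.
    transitivity (\int[mu]_(x in `[a, b]) (f x * k x - F x * k x)).
      by apply: eq_Rintegral => x _; rewrite /u; ring.
    by rewrite RintegralB// fF subrr.
  have iu (h : R -> R) : continuous h -> mu.-integrable `[a, b] (EFin \o (fun x => u x * h x)).
    move=> ch; apply: continuous_compact_integrable; first exact: segment_compact.
    by move=> x; apply: cvgM; [exact: cu|exact: (continuous_subspaceT ch)].
  have iu1 := iu _ (flat_alg_continuous (bump_alg s d1)).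
  have iu2 := iu _ (flat_alg_continuous (bump_alg t d2)).
  have : \int[mu]_(x in `[a, b]) (u x * k x) =
    I1^-1 * \int[mu]_(x in `[a, b]) (u x * bump s d1 x) -
    I2^-1 * \int[mu]_(x in `[a, b]) (u x * bump t d2 x).
    rewrite -!RintegralZl// -RintegralB//; try exact: iZ.
    by apply: eq_Rintegral => x _; rewrite /k; ring.
  rewrite uk0 => /eqP; rewrite eq_sym subr_eq0 => /eqP E12.
  rewrite E12 in H1; move: H1 H2; set J := _ * _ => H1 H2.
  rewrite (_ : u t - u s = (u t - J) + (J - u s)); last ring.
  apply: le_trans (ler_normD _ _) _; rewrite distrC; move: H1 H2; clear; lra.
apply/eqP; rewrite -subr_eq0 -normr_le0 leNgt; apply/negP => p.
by have := ne0 (`|u t - u s| / 3); rewrite divr_gt0// => /(_ isT); lra.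
Qed.

End dubois.

(** * Euclidean geometry of row vectors *)
Section euclid.
Context {R : realType} {n : nat}.
Implicit Types (x y z : 'rV[R]_n) (c : R).

Lemma dotC x y : dot x y = dot y x.
Proof. by apply: eq_bigr => i _; rewrite mulrC. Qed.

Lemma dotDl x y z : dot (x + y) z = dot x z + dot y z.
Proof. by rewrite /dot -big_split; apply: eq_bigr => i _; rewrite mxE mulrDl. Qed.

Lemma dotZl c x y : dot (c *: x) y = c * dot x y.
Proof. by rewrite /dot mulr_sumr; apply: eq_bigr => i _; rewrite mxE mulrA. Qed.

Lemma dotNl x y : dot (- x) y = - dot x y.
Proof. by rewrite -scaleN1r dotZl mulN1r. Qed.

Lemma dotDr x y z : dot z (x + y) = dot z x + dot z y.
Proof. by rewrite dotC dotDl !(dotC z). Qed.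

Lemma dotZr c x y : dot x (c *: y) = c * dot x y.
Proof. by rewrite dotC dotZl dotC. Qed.

Lemma dotNr x y : dot x (- y) = - dot x y.
Proof. by rewrite dotC dotNl dotC. Qed.

Definition dotE := (dotDl, dotDr, dotNl, dotNr, dotZl, dotZr).

Lemma dot_ge0 x : 0 <= dot x x.
Proof. by apply: sumr_ge0 => i _; rewrite -expr2 sqr_ge0. Qed.

Lemma sqr_coord_le_dot x i : x 0 i ^+ 2 <= dot x x.
Proof.
rewrite /dot (bigD1 i)//= -expr2 lerDl; apply: sumr_ge0 => j _.
by rewrite -expr2 sqr_ge0.
Qed.

Lemma dot_eq0 x : dot x x = 0 -> x = 0.
Proof.
move=> x0; apply/rowP => i; rewrite mxE; apply/eqP; rewrite -sqrf_eq0 eq_le sqr_ge0.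
by rewrite andbT -x0 sqr_coord_le_dot.
Qed.

Lemma Cauchy_Schwarz x y : dot x y ^+ 2 <= dot x x * dot y y.
Proof.
have [y0|y0] := eqVneq (dot y y) 0.
  rewrite y0 mulr0 (dot_eq0 y0) /dot big1 ?expr0n// => i _.
  by rewrite mxE mulr0.
have yp : 0 < dot y y by rewrite lt0r y0 dot_ge0.
have := dot_ge0 (dot y y *: x - dot x y *: y).
rewrite !dotE (dotC y x) => H.
rewrite -subr_ge0 -(pmulr_rge0 _ yp); apply: le_trans H _; rewrite le_eqVlt.
by apply/orP; left; apply/eqP; ring.
Qed.

Lemma enorm_ge0 x : 0 <= enorm x.
Proof. exact: sqrtr_ge0. Qed.

Lemma sqr_enorm x : enorm x ^+ 2 = dot x x.
Proof. by rewrite sqr_sqrtr// dot_ge0. Qed.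

Lemma enormZ c x : enorm (c *: x) = `|c| * enorm x.
Proof. by rewrite /enorm dotZl dotZr mulrA -expr2 sqrtrM ?sqr_ge0// sqrtr_sqr. Qed.

Lemma enormN x : enorm (- x) = enorm x.
Proof. by rewrite -scaleN1r enormZ normrN1 mul1r. Qed.

Lemma dot_le_enorm x y : `|dot x y| <= enorm x * enorm y.
Proof.
rewrite -ler_sqr ?nnegrE ?mulr_ge0 ?enorm_ge0//.
by rewrite exprMn !sqr_enorm real_normK ?num_real// Cauchy_Schwarz.
Qed.

Lemma enormD x y : enorm (x + y) <= enorm x + enorm y.
Proof.
rewrite -ler_sqr ?nnegrE ?addr_ge0 ?enorm_ge0//.
rewrite sqr_enorm !dotE (dotC y x) sqrrD !sqr_enorm.
have := le_trans (ler_norm _) (dot_le_enorm x y); lra.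
Qed.

Lemma enorm_dist x y : `|enorm x - enorm y| <= enorm (x - y).
Proof.
have h1 := enormD (x - y) y; rewrite subrK in h1.
have h2 := enormD (y - x) x; rewrite subrK -opprB enormN in h2.
by rewrite ler_norml; lra.
Qed.

Lemma coord_le_enorm x i : `|x 0 i| <= enorm x.
Proof.
rewrite -ler_sqr ?nnegrE ?enorm_ge0// real_normK ?num_real//.
by rewrite sqr_enorm sqr_coord_le_dot.
Qed.

Lemma enorm_le_sum x : enorm x <= \sum_i `|x 0 i|.
Proof.
rewrite -ler_sqr ?nnegrE ?enorm_ge0 ?sumr_ge0// sqr_enorm expr2 mulr_sumr.
rewrite /dot; apply: ler_sum => i _; apply: le_trans (ler_norm _) _.
rewrite normrM; apply: ler_wpM2r => //; rewrite (bigD1 i)//= lerDl.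
exact: sumr_ge0.
Qed.

Lemma nbhs_row (x : 'rV[R]_n) (P : 'I_n -> set R) :
  (forall i, nbhs (x 0 i) (P i)) -> \forall y \near x, forall i, P i ((y : 'rV[R]_n) 0 i).
Proof.
move=> H; exists (fun _ i => P i); first by move=> k i; rewrite (ord1 k).
by move=> y /= yP i; exact: yP.
Qed.

Lemma cvg_row (T : Type) (F : set_system T) (FF : Filter F) (f : T -> 'rV[R]_n) x :
  (forall i, (fun t => f t 0 i) @ F --> x 0 i) -> f @ F --> x.
Proof.
move=> H A [P xP PA].
have FP : F (fun t => forall ki : 'I_1 * 'I_n, P ki.1 ki.2 (f t ki.1 ki.2)).
  apply: filter_forall => -[k i] /=; rewrite (ord1 k).
  exact: (H i _ (xP 0 i)).
change (F (f @^-1` A)); apply: (@filterS _ F FF _ _ _ FP) => t Pt.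
by apply: PA => k i; exact: (Pt (k, i)).
Qed.

Lemma enorm_continuous : continuous (@enorm R n).
Proof.
move=> x; apply/(@cvgrPdist_le _ _ _ (nbhs x) (nbhs_filter x)) => e e0.
have d0 : 0 < e / n.+1%:R by rewrite divr_gt0// ltr0n.
have nx := @nbhs_row x (fun i => [set t | `|x 0 i - t| < e / n.+1%:R]) (fun i => nbhsx_ballx _ _ d0).
apply: (@filterS _ (nbhs x) (nbhs_filter x) _ _ _ nx) => y /= xy; apply: le_trans (enorm_dist x y) _.
apply: le_trans (enorm_le_sum _) _.
apply: (@le_trans _ _ (\sum_(i < n) e / n.+1%:R)).
  by apply: ler_sum => i _; rewrite !mxE; apply/ltW.
rewrite sumr_const card_ord -[leLHS]mulr_natr mulrAC ler_pdivrMr ?ltr0n//.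
by apply: ler_wpM2l; [exact: ltW|rewrite ler_nat; exact: leqnSn].
Qed.

End euclid.

(** * Functions with continuous partial derivatives *)
Section calculus.
Context {R : realType} {n : nat}.
Implicit Types (x y z h : 'rV[R]_n) (F W : 'rV[R]_n -> R).

Lemma isD_partial F i p (t : R) : derivable F (p + t *: delta_mx 0 i) (delta_mx 0 i) ->
  is_derive t 1 (fun s : R => F (p + s *: delta_mx 0 i)) (partial i F (p + t *: delta_mx 0 i)).
Proof.
move=> dF.
have E : (fun s : R => s^-1 *: (F (s *: delta_mx 0 i + (p + t *: delta_mx 0 i)) - F (p + t *: delta_mx 0 i)))
  = (fun s : R => s^-1 *: (F (p + (s *: 1 + t) *: delta_mx 0 i) - F (p + t *: delta_mx 0 i))).
  apply/funext => s; congr (_ *: (F _ - _)).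
  by rewrite [s *: 1]mulr1 scalerDl addrCA.
split; first by move: dF; rewrite /derivable E.
by rewrite /partial/derive E.
Qed.

Lemma MVT_signed (f df : R -> R) (s : R) : (forall u : R, is_derive u 1 f (df u)) ->
  exists2 c, `|c| <= `|s| & f s - f 0 = df c * s.
Proof.
move=> fd; have cf : continuous f by move=> u; exact: isD_continuous (fd u).
have [s0|/ltW s0] := leP 0 s.
  have [c] := @MVT_segment R f df 0 s s0 (fun u _ => fd u) (continuous_subspaceT cf).
  by rewrite in_itv/= subr0 => /andP[c0 cs] ->; exists c => //; rewrite !ger0_norm.
have [c] := @MVT_segment R f df s 0 s0 (fun u _ => fd u) (continuous_subspaceT cf).
rewrite in_itv/= => /andP[sc c0] E; exists c; first by rewrite !ler0_norm// lerN2.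
by rewrite -opprB E; ring.
Qed.

(** Going from z to z + h one coordinate at a time, each increment is, by the
mean value theorem, a value of one partial derivative at a point close to z. *)
Lemma partials_expansion F z (e : R) : has_continuous_partials F -> 0 < e ->
  exists2 d, 0 < d & forall h, (forall i, `|h 0 i| < d) ->
    `|F (z + h) - F z - dot (grad F z) h| <= e * \sum_i `|h 0 i|.
Proof.
move=> HF e0.
have [d d0 dP] : exists2 d : R, 0 < d & forall y, (forall i, `|y 0 i| < d) ->
    forall i, `|partial i F (z + y) - partial i F z| <= e.
  have H i : \forall d \near (0:R)^'+, forall y, (forall i, `|y 0 i| < d) ->
      `|partial i F (z + y) - partial i F z| <= e.
    have [_ /(_ z) ci] := HF i.
    have := (@cvgrPdist_le _ _ _ (nbhs z) (nbhs_filter z) _ _).1 ci e e0.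
    move=> /nbhs_ballP[d /= d0 dP]; near=> s => y ys.
    rewrite distrC; apply: dP; split => // k j.
    rewrite (ord1 k) /ball/= mxE opprD addrA subrr sub0r normrN.
    by apply: lt_le_trans (ys j) _; near: s; exact: nbhs_right_le.
  have Hall := filter_forall (at_right_proper_filter (0:R)) H.
  have [d [Hd d0]] := filter_ex (filterI Hall (nbhs_right_gt (0:R))).
  by exists d => // y yd i; exact: Hd.
exists d => // h hd.
pose hk k : 'rV[R]_n := \row_i (if (i < k)%N then h 0 i else 0).
have hkd k i : `|hk k 0 i| < d by rewrite mxE; case: ifP; rewrite ?normr0.
suff H k : (k <= n)%N -> `|F (z + hk k) - F z - \sum_(i < n | (i < k)%N) partial i F z * h 0 i|
    <= e * \sum_(i < n | (i < k)%N) `|h 0 i|.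
  have := H n (leqnn n).
  rewrite (_ : hk n = h); last by apply/rowP => i; rewrite mxE ltn_ord.
  have bn (f : 'I_n -> R) : \sum_(i < n | (i < n)%N) f i = \sum_(i < n) f i.
    by apply: eq_bigl => i; rewrite ltn_ord.
  rewrite !bn /dot (_ : \sum_i grad F z 0 i * h 0 i = \sum_i partial i F z * h 0 i)//.
  by apply: eq_bigr => i _; rewrite mxE.
elim: k => [|k IH] kn.
  rewrite (_ : hk 0%N = 0); last by apply/rowP => i; rewrite !mxE.
  by rewrite addr0 subrr !big_pred0_eq subrr normr0 mulr0.
pose i0 := Ordinal kn.
have hS : hk k.+1 = hk k + h 0 i0 *: delta_mx 0 i0.
  apply/rowP => i; rewrite !mxE eqxx /= ltnS leq_eqVlt.
  case: (eqVneq i i0) => [->|ne] /=; first by rewrite eqxx ltnn mulr1 add0r.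
  by rewrite mulr0 addr0 (_ : (_ == _) = false)//;
  apply/negbTE; apply: contra ne => /eqP ik; apply/eqP/val_inj.
have bS (f : 'I_n -> R) : \sum_(i < n | (i < k.+1)%N) f i = f i0 + \sum_(i < n | (i < k)%N) f i.
  rewrite (bigD1 i0) ?ltnS ?leqnn//=; congr (_ + _); apply: eq_bigl => i.
  by rewrite ltnS ltn_neqAle andbC -val_eqE.
rewrite !bS.
have [c cs E] := @MVT_signed _ _ (h 0 i0)
  (fun t => isD_partial ((HF i0).1 (z + hk k + t *: delta_mx 0 i0))).
rewrite scale0r addr0 -addrA -hS in E.
have {}IH := IH (ltnW kn).
rewrite (_ : _ - _ = (F (z + hk k) - F z - \sum_(i < n | (i < k)%N) partial i F z * h 0 i) +
  (F (z + hk k.+1) - F (z + hk k) - partial i0 F z * h 0 i0)); last ring.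
apply: le_trans (ler_normD _ _) _; rewrite mulrDr addrC; apply: lerD => //.
rewrite E -mulrBl normrM; apply: ler_wpM2r => //.
rewrite -addrA; apply: dP => i.
have -> : (hk k + c *: delta_mx 0 i0) 0 i = if i == i0 then c else hk k 0 i.
  rewrite !mxE eqxx /=; case: (eqVneq i i0) => [->|_]; first by rewrite ltnn add0r mulr1.
  by rewrite mulr0 addr0.
by case: ifP => // _; exact: le_lt_trans cs (hd _).
Unshelve. all: by end_near. Qed.

Lemma isD_line F x y (t : R) : has_continuous_partials F ->
  is_derive t 1 (fun s : R => F (x + s *: y)) (dot (grad F (x + t *: y)) y).
Proof.
move=> HF; apply/isD_epsP => e e0.
pose S := \sum_i `|y 0 i| + 1.
have S0 : 0 < S by rewrite ltr_wpDl// sumr_ge0.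
have [d d0 dP] := partials_expansion (x + t *: y) HF (divr_gt0 e0 S0).
near=> s.
have := dP (s *: y); rewrite dotZr.
have -> : x + t *: y + s *: y = x + (s + t) *: y by rewrite scalerDl (addrC (s *: y)) addrA.
have sS : `|s| * S < d.
  rewrite -ltr_pdivlMr//; near: s; apply: (@pseudometric_normed_Zmodule.nbhs0_lt _ R).
  exact: divr_gt0.
move=> H; rewrite [_ * s]mulrC; apply: le_trans (H _) _ => [i|].
  rewrite mxE normrM; apply: le_lt_trans sS; apply: ler_wpM2l => //.
  by rewrite /S (bigD1 i)//= -addrA lerDl addr_ge0// sumr_ge0.
under eq_bigr do rewrite mxE normrM.
rewrite -mulr_sumr mulrCA [leRHS]mulrC; apply: ler_wpM2l => //.
by rewrite mulrAC ler_pdivrMr// ler_wpM2l ?ltW// ltrDl.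
Unshelve. all: by end_near. Qed.

End calculus.

(** * The potential near a well *)
Section potential.
Context {R : realType} {n : nat}.
Implicit Types (x y z h : 'rV[R]_n) (F W : 'rV[R]_n -> R).

Lemma mean_value_segment F a y : has_continuous_partials F ->
  exists2 t : R, 0 <= t <= 1 & F (a + y) - F a = dot (grad F (a + t *: y)) y.
Proof.
move=> HF; have fd t := @isD_line _ _ F a y t HF.
have cf : continuous (fun s : R => F (a + s *: y)) by move=> t; exact: isD_continuous (fd t).
have [t] := @MVT_segment R _ _ 0 1 ler01 (fun u _ => fd u) (continuous_subspaceT cf).
rewrite in_itv/= scale1r scale0r addr0 subr0 mulr1 => t01 E.
by exists t.
Qed.

Lemma bounded_on_box F a : continuous F ->
  exists2 C, 0 <= C & forall y, (forall i, `|y 0 i| <= 1) -> `|F (a + y)| <= C.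
Proof.
move=> cF.
pose B := [set v : 'rV[R]_n | forall i, `[a 0 i - 1, a 0 i + 1]%classic (v ord0 i)].
have cB : compact B.
  apply: (@rV_compact R n (fun i => `[a 0 i - 1, a 0 i + 1]%classic)) => i.
  exact: segment_compact.
have cFB : compact (F @` B).
  by apply: continuous_compact => //; exact: continuous_subspaceT.
have [M [_ MP]] := compact_bounded cFB.
exists (`|M| + 1); first by rewrite addr_ge0.
move=> y y1; apply: (MP (`|M| + 1)); first by rewrite (le_lt_trans (ler_norm _))// ltrDl.
exists (a + y) => // i /=; rewrite in_itv/= !mxE.
by have := y1 i; rewrite ler_norml; lra.
Qed.

Lemma partial_min0 W a i : has_continuous_partials W -> (forall x, W a <= W x) ->
  partial i W a = 0.
Proof.
move=> HW Wa; have [/(_ (a + 0 *: delta_mx 0 i)) dW _] := HW i.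
have := isD_partial dW; rewrite scale0r addr0 => H.
apply/esym; apply: isD_touch (isD_cst (W a) 0) H; last by rewrite scale0r addr0.
by exists 1 => //= t _; exact: Wa.
Qed.

(** The gradient vanishes at the minimum a, so it is at most linear near a
because the second derivatives are bounded there; integrate once more. *)
Lemma quadratic_bound W a : C2 W -> (forall x, 0 <= W x) -> W a = 0 ->
  exists2 M, 0 < M & forall y, enorm y <= 1 -> W (a + y) <= M * enorm y ^+ 2.
Proof.
move=> [_ HW HW2] W0 Wa.
have box y : enorm y <= 1 -> forall i, `|y 0 i| <= 1.
  by move=> y1 i; exact: le_trans (coord_le_enorm y i) y1.
have tle y (t : R) : 0 <= t <= 1 -> enorm (t *: y) <= enorm y.
  by move=> /andP[t0 t1]; rewrite enormZ ger0_norm// ler_piMl// enorm_ge0.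
have [C C0 CP] : exists2 C, 0 <= C & forall i j y, enorm y <= 1 ->
    `|partial j (partial i W) (a + y)| <= C.
  have /boolp.choice[C CP] : forall ij : 'I_n * 'I_n, exists C, 0 <= C /\
      forall y, enorm y <= 1 -> `|partial ij.2 (partial ij.1 W) (a + y)| <= C.
    move=> [i j] /=; have [_ cij] := HW2 i j.
    by have [C C0 CP] := bounded_on_box a cij; exists C; split => // y /box /CP.
  exists (\sum_ij C ij); first by apply: sumr_ge0 => ij _; case: (CP ij).
  move=> i j y y1; have [_ /(_ _ y1)] := CP (i, j); move/le_trans; apply.
  by rewrite (bigD1 (i, j))//= lerDl; apply: sumr_ge0 => ij _; case: (CP ij).
have gradB i y : enorm y <= 1 -> `|partial i W (a + y)| <= n%:R * C * enorm y.
  move=> y1; have [t t01 E] := mean_value_segment a y (HW2 i).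
  have : partial i W a = 0 by apply: partial_min0 => // x; rewrite Wa.
  move=> pa; rewrite pa subr0 in E; rewrite E /dot.
  apply: le_trans (ler_norm_sum _ _ _) _.
  have -> : n%:R * C * enorm y = \sum_(j < n) C * enorm y.
    by rewrite sumr_const card_ord -[RHS]mulr_natl mulrA.
  apply: ler_sum => j _; rewrite normrM mxE; apply: ler_pM => //.
    by apply: CP; exact: le_trans (tle _ _ t01) y1.
  exact: coord_le_enorm.
exists (n%:R * (n%:R * C) + 1); first by rewrite ltr_wpDl// mulr_ge0// mulr_ge0.
move=> y y1; have [t t01 E] := mean_value_segment a y HW.
rewrite Wa subr0 in E; rewrite E.
apply: le_trans (ler_norm _) _; apply: le_trans (ler_norm_sum _ _ _) _.
apply: (@le_trans _ _ (\sum_(i < n) (n%:R * C) * enorm y ^+ 2)).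
  apply: ler_sum => i _; rewrite normrM mxE expr2 mulrA; apply: ler_pM => //.
    apply: le_trans (gradB _ _ (le_trans (tle _ _ t01) y1)) _.
    by apply: ler_wpM2l; [exact: mulr_ge0|exact: tle].
  exact: coord_le_enorm.
rewrite sumr_const card_ord -[leLHS]mulr_natl mulrA; apply: ler_wpM2r; first exact: sqr_ge0.
by rewrite lerDl.
Qed.

(** The radial derivative of W at radius u is at least c0 u^(p - 1), which is
at least its value at the smaller radius s. *)
Lemma radial_gap W a (r c0 p s t : R) th : has_continuous_partials W ->
  radially_monotone_near W a r c0 p -> 0 <= c0 -> 1 <= p -> enorm th = 1 ->
  0 <= s -> s <= t -> t < r ->
  c0 * s `^ (p - 1) * (t - s) <= W (a + t *: th) - W (a + s *: th).
Proof.
move=> HW rad c00 p1 th1 s0 st tr.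
have fd u := @isD_line _ _ W a th u HW.
have cf : continuous (fun s : R => W (a + s *: th)) by move=> u; exact: isD_continuous (fd u).
move: st; rewrite le_eqVlt => /predU1P[->|st]; first by rewrite !subrr mulr0.
have [u] := @MVT R _ _ s t st (fun u _ => fd u) (continuous_subspaceT cf).
rewrite in_itv/= => /andP[su ut] ->.
rewrite ler_pM2r ?subr_gt0//.
have u0 : 0 < u by exact: le_lt_trans su.
have := rad (a + u *: th).
rewrite /eball /= addrAC subrr add0r enormZ th1 mulr1 gtr0_norm// => /(_ (lt_trans ut tr)).
rewrite dotZr -(mulr_powRB1 (ltW u0)); last lra.
rewrite mulrCA ler_pM2l// => H; apply: le_trans H.
by apply: ler_wpM2l => //; apply: ge0_ler_powR; rewrite ?nnegrE ?subr_ge0// ltW.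
Qed.

End potential.

(** * The envelope *)
Section envelope_ode.
Context {R : realType}.
Variables (c p eps s0 : R) (E : R -> R).
Hypotheses (c0 : 0 < c) (p2 : 2 <= p) (e0 : 0 < eps) (e1 : eps < 1).
Hypothesis (envE : envelope c p eps s0 E).

Let E_ge0 s : s0 <= s -> 0 <= E s. Proof. by case: envE => H _ _ _ _; exact: H. Qed.
Let Es0 : E s0 = eps. Proof. by case: envE. Qed.
Let E' := derive1 E.

Let dE s : s0 < s -> is_derive s 1 E (E' s).
Proof. by case: envE => _ _ H _ _ /H[d _ _]; exact: isD_derive1. Qed.

Let dE' s : s0 < s -> is_derive s 1 E' (c * E s `^ (p - 1)).
Proof. by case: envE => _ _ H _ _ /H[_ d <-]; exact: isD_derive1. Qed.

Let cE a b : s0 <= a -> {within `[a, b], continuous E}.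
Proof.
case: envE => _ H _ _ _ sa; apply: continuous_subspaceW H => x /=.
by rewrite !in_itv/= andbT => /andP[/(le_trans sa)].
Qed.

Let E_lim (e : R) : 0 < e -> exists T, forall t, T < t -> E t < e.
Proof.
case: envE => _ _ _ _ H he.
have [T [_ TP]] := (cvgrPdist_lt _ _).1 H e he.
exists T => t /TP /=; rewrite sub0r normrN; apply: le_lt_trans; exact: ler_norm.
Qed.

Let mvt (f df : R -> R) (a b : R) : s0 < a -> a <= b ->
  (forall s, s0 < s -> is_derive s 1 f (df s)) ->
  exists2 x, a <= x <= b & f b - f a = df x * (b - a).
Proof.
move=> sa ab fd.
have fd' x : x \in `]a, b[ -> is_derive x 1 f (df x).
  by rewrite in_itv/= => /andP[/(lt_trans sa) ? _]; exact: fd.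
have cf : {within `[a, b], continuous f}.
  apply: derivable_within_continuous => x; rewrite in_itv/= => /andP[ax _].
  exact: isD_derivable (fd x (lt_le_trans sa ax)).
have [x] := MVT_segment ab fd' cf.
by rewrite in_itv/= => xab xE; exists x.
Qed.

Let mvtE (a b : R) : s0 <= a -> a <= b ->
  exists2 x, a <= x <= b & E b - E a = E' x * (b - a) /\ (a < b -> s0 < x).
Proof.
move=> sa; rewrite le_eqVlt => /predU1P[<-|ab].
  by exists a; rewrite ?lexx// !subrr mulr0 ltxx.
have fd' x : x \in `]a, b[ -> is_derive x 1 E (E' x).
  by rewrite in_itv/= => /andP[/(le_lt_trans sa) /dE].
have [x] := MVT ab fd' (cE (b := b) sa).
rewrite in_itv/= => /andP[ax xb] xE; exists x; first by rewrite !ltW.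
by split => // _; exact: le_lt_trans ax.
Qed.

(* E'' >= 0: the envelope is convex, hence nonincreasing since it tends to 0,
   and E' tends to 0 because - E s <= E' (s + 1). *)
Let E'_homo s t : s0 < s -> s <= t -> E' s <= E' t.
Proof.
move=> ss st; rewrite -subr_ge0.
have [x /andP[sx _] ->] := mvt ss st dE'.
rewrite mulr_ge0 ?subr_ge0// mulr_ge0 ?powR_ge0// ltW//.
Qed.

Let E'_le0 s : s0 < s -> E' s <= 0.
Proof.
move=> ss; rewrite leNgt; apply/negP => h.
have [T TP] := E_lim h.
pose t := Num.max (s + 1) (T + 1).
have st : s <= t by rewrite le_max; apply/orP; left; lra.
have [x /andP[sx xt] xE] := mvt ss st dE.
have : E t < E' s by apply: TP; rewrite /t lt_max; apply/orP; right; lra.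
have E's := E'_homo ss sx; have := E_ge0 (ltW ss).
have : 1 <= t - s by rewrite lerBrDl addrC le_max; apply/orP; left; rewrite addrC.
nra.
Qed.

Lemma envelope_le s : s0 <= s -> E s <= eps.
Proof.
move=> ss; rewrite -Es0 -subr_le0; move: ss; rewrite le_eqVlt => /predU1P[<-|ss].
  by rewrite subrr.
have [x _ [-> /(_ ss) sx]] := mvtE (lexx s0) (ltW ss).
by rewrite pmulr_lle0 ?subr_gt0// E'_le0.
Qed.

Let E'_lim (e : R) : 0 < e -> exists T, forall t, T < t -> s0 < t /\ - e < E' t.
Proof.
move=> he; have [T TP] := E_lim he.
exists (Num.max T s0 + 1) => t; rewrite -ltrBrDr gt_max => /andP[Tt st].
have st' : s0 < t by lra.
split => //; have tt : t - 1 <= t by lra.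
have [x /andP[tx xt] xE] := mvt st tt dE.
have := TP _ Tt; have := E_ge0 (ltW st').
have := E'_homo (lt_le_trans st tx) xt.
have : E t - E (t - 1) = E' x by rewrite xE; ring.
lra.
Qed.

Let E_pow s : s0 <= s -> E s `^ (p - 1) <= E s.
Proof.
have p1 : 0 < p - 1 by move: p2; lra.
move=> ss; have := E_ge0 ss; rewrite le_eqVlt => /predU1P[<-|Ep].
  by rewrite powR0// gt_eqF.
by apply: ge1r_powR; [rewrite Ep (le_trans (envelope_le ss))// ltW|move: p2; lra].
Qed.

Let k := Num.sqrt c.
Let k0 : 0 < k. Proof. by rewrite sqrtr_gt0. Qed.
Let kk : k * k = c. Proof. by rewrite -expr2 sqr_sqrtr// ltW. Qed.

Let is_exp (a : R) (s : R) : is_derive s 1 (fun t => expR (a * t)) (expR (a * s) * a).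
Proof.
have := @isD_comp _ expR (fun t => a * t) s _ _ (is_derive_expR (a * s)) (isD_scale a (isD_id s)).
by rewrite mulr1.
Qed.

(* E'' <= c E since E <= 1 and p >= 2. Hence G = E' + k E, with k^2 = c,
   satisfies G' <= k G. A negative value of G would then persist for ever,
   while G tends to a nonnegative limit. *)
Let E'_ge s : s0 < s -> - (k * E s) <= E' s.
Proof.
move=> ss; rewrite leNgt; apply/negP => h.
pose G t := E' t + k * E t.
have Gs : G s < 0 by rewrite /G; lra.
have mono t : s <= t -> G t <= G s.
  move=> st.
  pose Q t := G t * expR (- k * t).
  have dQ u : s0 < u -> is_derive u 1 Q (G u * (expR (- k * u) * - k) +
      expR (- k * u) * (c * E u `^ (p - 1) + k * E' u)).
    move=> su; apply: isD_mul (is_exp _ _); apply: isD_add (dE' su) _.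
    exact: isD_scale (dE su).
  have [x /andP[sx xt] QE] := mvt ss st dQ.
  have sx0 := lt_le_trans ss sx.
  have : Q t - Q s <= 0.
    rewrite QE mulr_le0_ge0 ?subr_ge0//.
    have -> : G x * (expR (- k * x) * - k) + expR (- k * x) * (c * E x `^ (p - 1) + k * E' x)
      = expR (- k * x) * (c * E x `^ (p - 1) - k * k * E x) by rewrite /G; ring.
    rewrite pmulr_rle0 ?expR_gt0// kk -mulrBr pmulr_rle0// subr_le0.
    exact: E_pow (ltW sx0).
  rewrite subr_le0 /Q -ler_pdivlMr ?expR_gt0// -mulrA -expRN -expRD.
  move/le_trans; apply; rewrite -[leRHS]mulr1 ler_nM2l//.
  apply: le_trans (expR_ge1Dx _); rewrite lerDl.
  by rewrite !mulNr opprK addrC subr_ge0 ler_pM2l.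
have [T1 T1P] := E'_lim (e := - G s) ltac:(lra).
pose t := Num.max s T1 + 1.
have Tt : T1 < t.
  by rewrite /t (@le_lt_trans _ _ (Num.max s T1)) ?ltrDl// le_max lexx orbT.
have [_ h1] := T1P _ Tt.
have st : s <= t.
  by rewrite /t (@le_trans _ _ (Num.max s T1)) ?lerDl// le_max lexx.
have := mono _ st; rewrite {1}/G.
have := mulr_ge0 (ltW k0) (E_ge0 (le_trans (ltW ss) st)); lra.
Qed.

(** E exp(k s) is nondecreasing, as E' >= - k E. Positivity matters because
neither E^p nor the negative powers of E occurring below would be
differentiable at a zero. *)
Lemma envelope_gt0 s : s0 <= s -> 0 < E s.
Proof.
rewrite le_eqVlt => /predU1P[<-|ss]; first by rewrite Es0.
pose Q t := E t * expR (k * t).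
have fd' u : u \in `]s0, s[ ->
    is_derive u 1 Q (E u * (expR (k * u) * k) + expR (k * u) * E' u).
  by rewrite in_itv/= => /andP[su _]; exact: isD_mul (dE su) (is_exp _ _).
have cQ : {within `[s0, s], continuous Q}.
  move=> x; apply: cvgM; first exact: cE.
  by apply: continuous_subspaceT => u; exact: isD_continuous (is_exp k u).
have [x] := MVT ss fd' cQ.
rewrite in_itv/= => /andP[sx xs] QE.
have : Q s0 <= Q s.
  rewrite -subr_ge0 QE mulr_ge0 ?subr_ge0 ?(ltW ss)//.
  have -> : E x * (expR (k * x) * k) + expR (k * x) * E' x =
    expR (k * x) * (E' x + k * E x) by ring.
  by rewrite mulr_ge0 ?expR_ge0//; have := E'_ge sx; lra.
rewrite /Q Es0 => /(lt_le_trans (mulr_gt0 e0 (expR_gt0 _))).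
by rewrite pmulr_lgt0 ?expR_gt0.
Qed.

Definition envelope_rate := Num.sqrt (2 * c / p).

(** Conservation of the energy E'^2 / 2 - (c / p) E^p, which tends to 0 at
infinity. *)
Lemma envelope_derive s : s0 < s -> is_derive s 1 E (- envelope_rate * E s `^ (p / 2)).
Proof.
move=> ss; apply: isD_eq (dE ss) _.
have pp : 0 < p by move: p2; lra.
pose H t := 2^-1 * (E' t * E' t) - c / p * E t `^ p.
have dH t : s0 < t -> is_derive t 1 H 0.
  move=> st; have Et := envelope_gt0 (ltW st).
  have dp := @isD_comp _ (fun u => u `^ p) E t _ _ (is_derive1_powR p Et) (dE st).
  apply: isD_eq (isD_sub (isD_scale 2^-1 (isD_mul (dE' st) (dE' st))) (isD_scale (c / p) dp)) _.
  by field; rewrite gt_eqF.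
have Hle e : 0 < e -> e < 1 -> `|H s| <= e * (1 + c / p).
  move=> he he1.
  have [T1 T1P] := E_lim he; have [T2 T2P] := E'_lim he.
  pose t := Num.max s (Num.max T1 T2) + 1.
  have lt1 x : x <= Num.max s (Num.max T1 T2) -> x < t.
    by move=> h; rewrite /t (le_lt_trans h)// ltrDl.
  have st : s < t by apply: lt1; rewrite le_max lexx.
  have Et : E t < e by apply: T1P; apply: lt1; rewrite !le_max lexx !orbT.
  have [_ E't] : s0 < t /\ - e < E' t by apply: T2P; apply: lt1; rewrite !le_max lexx !orbT.
  have [x _] := mvt ss (ltW st) dH; rewrite mul0r => /eqP; rewrite subr_eq0 => /eqP <-.
  have st0 := lt_trans ss st.
  have E'0 := E'_le0 st0; have Ep := envelope_gt0 (ltW st0).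
  have Epp : E t `^ p <= E t.
    by apply: ge1r_powR; [rewrite Ep (le_trans (envelope_le (ltW st0)))// ltW|move: p2; lra].
  have Ep0 := powR_ge0 (E t) p.
  have cp : 0 < c / p by rewrite divr_gt0.
  rewrite ler_norml /H; apply/andP; split; nra.
have H0 : H s = 0.
  apply/eqP; rewrite -normr_le0 leNgt; apply/negP => h.
  have cp : 0 < 1 + c / p by rewrite addr_gt0// divr_gt0.
  pose e := Num.min (1/2) (`|H s| / (2 * (1 + c / p))).
  have he : 0 < e by rewrite lt_min divr_gt0// ?divr_gt0// mulr_gt0.
  have he1 : e < 1 by rewrite gt_min; apply/orP; left; lra.
  have := Hle e he he1; apply/negP; rewrite -ltNge.
  apply: (@le_lt_trans _ _ (`|H s| / 2)); last lra.
  rewrite -ler_pdivlMr// -mulrA -invfM ge_min; apply/orP; right.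
  by rewrite lexx.
have E'0 := E'_le0 ss.
have m0 : 0 <= envelope_rate * E s `^ (p / 2) by rewrite mulr_ge0 ?sqrtr_ge0 ?powR_ge0.
apply/eqP; rewrite mulNr -eqr_oppLR -(@eqrXn2 _ 2)//; last by rewrite oppr_ge0.
rewrite sqrrN exprMn sqr_sqrtr; last by rewrite divr_ge0 ?mulr_ge0// ltW.
rewrite -(powR_mulrn 2 (powR_ge0 _ _)) -powRrM (_ : p / 2 * 2%:R = p); last by field.
apply/eqP; move: H0; rewrite /H => /eqP; rewrite subr_eq0 => /eqP H0.
by rewrite expr2 -[LHS](mulKf (x := 2^-1)) ?invr_eq0// H0 invrK; ring.
Qed.

End envelope_ode.

(** * Curves projected on a moving sphere *)
Section radial_projection.
Context {R : realType} {n : nat}.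
Implicit Types (x y v w : R -> 'rV[R]_n) (a g gw : 'rV[R]_n).

Definition isDv (t : R) x g := forall i, is_derive t 1 (fun s => x s 0 i) (g 0 i).

Lemma isDv_unique t x g g' : isDv t x g -> isDv t x g' -> g = g'.
Proof. by move=> H H'; apply/rowP => i; exact: isD_unique (H i) (H' i). Qed.

Lemma isDv_near t x y g : (\forall s \near t, x s = y s) -> isDv t x g -> isDv t y g.
Proof.
move=> xy xg i; apply: isD_near (xg i).
by apply: filterS xy => s ->.
Qed.

Lemma isDv_sub_cst t x g a : isDv t x g -> isDv t (fun s => x s - a) g.
Proof.
move=> xg i; rewrite (_ : (fun s => _) = (fun s => x s 0 i - a 0 i)).
  by apply: isD_eq (isD_sub (xg i) (isD_cst _ t)) _; rewrite subr0.
by apply/funext => s; rewrite !mxE.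
Qed.

Lemma isD_dot t x y g g' : isDv t x g -> isDv t y g' ->
  is_derive t 1 (fun s => dot (x s) (y s)) (dot (x t) g' + dot g (y t)).
Proof.
move=> xg yg; rewrite /dot -big_split /=.
by apply: isD_sum => i; apply: isD_eq (isD_mul (xg i) (yg i)) _; rewrite (mulrC (g 0 i)).
Qed.

Lemma isD_enorm t x g : isDv t x g -> 0 < enorm (x t) ->
  is_derive t 1 (fun s => enorm (x s)) (dot (x t) g / enorm (x t)).
Proof.
move=> xg x0; have d0 : 0 < dot (x t) (x t) by rewrite -sqr_enorm exprn_gt0.
have := @isD_comp _ Num.sqrt (fun s => dot (x s) (x s)) t _ _ (is_derive1_sqrt d0) (isD_dot xg xg).
move/isD_eq; apply; rewrite -/(enorm (x t)) (dotC g); field.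
by rewrite gt_eqF.
Qed.

Lemma isDv_continuous t x g : isDv t x g -> {for t, continuous x}.
Proof. by move=> xg; apply: cvg_row => i; exact: isD_continuous (xg i). Qed.

Lemma isDv_enorm_continuous t x g : isDv t x g -> {for t, continuous (fun s => enorm (x s))}.
Proof.
move=> xg; apply: (@continuous_comp _ _ _ x (@enorm R n)).
  exact: isDv_continuous xg.
exact: enorm_continuous.
Qed.

(** With k = e / rho, the velocity of w is k g + k' x. Its angular part is that
of x contracted by k, and its radial part is e', whence
|w'|^2 = k^2 (|g|^2 - rho'^2) + e'^2 with 0 <= k <= 1 and, by Cauchy-Schwarz,
rho'^2 <= |g|^2. *)
Lemma projection_speed t x w a g gw (e : R -> R) (e' : R) :
  isDv t x g -> isDv t w gw -> is_derive t 1 e e' -> 0 < e t -> e t < enorm (x t) ->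
  (\forall s \near t, w s = a + (e s / enorm (x s)) *: x s) ->
  dot gw gw <= dot g g - (dot (x t) g / enorm (x t)) ^+ 2 + e' ^+ 2.
Proof.
move=> xg wg ee e0 ex wE.
have rho0 : 0 < enorm (x t) by exact: lt_trans ex.
have rn0 : enorm (x t) != 0 by rewrite gt_eqF.
have dr := isD_enorm xg rho0.
set r' := _ / _ in dr *; set rho := enorm (x t) in rho0 ex rn0 *.
have dk := isD_mul ee (@isD_inv _ (fun s => enorm (x s)) t _ rn0 dr).
set k' := _ + _ in dk; pose k := e t / rho.
have gwE : gw = k *: g + k' *: x t.
  apply: (isDv_unique wg); apply: isDv_near (_ : isDv t (fun s => a + (e s / enorm (x s)) *: x s) _).
    by apply: filterS wE => s ->.
  move=> i; rewrite (_ : (fun s => _) = (fun s => a 0 i + (e s / enorm (x s)) * x s 0 i)).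
    apply: isD_eq (isD_add (isD_cst _ t) (isD_mul dk (xg i))) _.
    by rewrite !mxE add0r (mulrC k').
  by apply/funext => s; rewrite !mxE.
have xx : dot (x t) (x t) = rho ^+ 2 by rewrite sqr_enorm.
have xgE : dot (x t) g = rho * r' by rewrite /r' -/rho; field.
have k'E : k' * rho = e' - k * r' by rewrite /k' /k /= -/rho; field.
have -> : dot gw gw = k ^+ 2 * (dot g g - r' ^+ 2) + e' ^+ 2.
  rewrite gwE !dotE (dotC g) xx xgE.
  have -> : e' = k' * rho + k * r' by rewrite k'E subrK.
  ring.
have k0 : 0 <= k by rewrite divr_ge0// ltW.
have k1 : k <= 1 by rewrite ler_pdivrMr// mul1r ltW.
rewrite lerD2r ler_piMl//; last by rewrite exprn_ile1.
rewrite subr_ge0 /r' expr_div_n ler_pdivrMr ?exprn_gt0//.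
by rewrite mulrC -xx; exact: Cauchy_Schwarz.
Qed.

(** The scalar product of v - w and x is nonnegative and vanishes at t, so its
derivative vanishes there; and it determines v - w, which is collinear to x. *)
Lemma projection_contact t x w a v g gw (l : R -> R) :
  isDv t v g -> isDv t w gw -> (forall s, x s = v s - a) -> 0 < enorm (x t) -> w t = v t ->
  (\forall s \near t, 0 <= l s /\ v s - w s = l s *: x s) -> gw = g.
Proof.
move=> vg wg xE x0 wv H.
have xg : isDv t x g by rewrite (_ : x = fun s => v s - a); [exact: isDv_sub_cst|exact/funext].
have zg : isDv t (fun s => v s - w s) (g - gw).
  move=> i; rewrite (_ : (fun s => _) = (fun s => v s 0 i - w s 0 i)).
    by rewrite !mxE; exact: isD_sub (vg i) (wg i).
  by apply/funext => s; rewrite !mxE.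
have fd := isD_dot zg xg; have xxd := isD_dot xg xg.
have z0 (y : 'rV[R]_n) : dot (v t - w t) y = 0.
  by rewrite wv subrr -(scale0r 0) dotZl mul0r.
have f0 : 0 = dot (v t - w t) g + dot (g - gw) (x t).
  apply: (isD_touch _ _ (isD_cst 0 t) fd); last by rewrite z0.
  by apply: filterS H => s [l0 ->]; rewrite dotZl mulr_ge0// dot_ge0.
apply/esym/eqP; rewrite -subr_eq0; apply/eqP/rowP => i; rewrite [RHS]mxE.
have e1 := isD_mul (zg i) xxd; have e2 := isD_mul fd (xg i).
have : is_derive t 1 (fun s => (v s - w s) 0 i * dot (x s) (x s)) 0.
  apply: isD_eq (isD_near _ e2) _.
    by apply: filterS H => s [_ ->]; rewrite dotZl mxE; ring.
  by rewrite -f0 z0 mul0r mulr0 addr0.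
move/(isD_unique e1); rewrite wv subrr mxE mul0r add0r => /eqP.
rewrite mulf_eq0 -sqr_enorm sqrf_eq0 (gt_eqF x0)/= => /eqP; by [].
Qed.

End radial_projection.

(** * Curves with locally square integrable weak derivative *)
Section h1loc.
Context {R : realType} {n : nat}.
Notation mu := (@lebesgue_measure R).
Implicit Types (u v w : R -> 'rV[R]_n).

Lemma locally_integrable_sqr (g : R -> R) : measurable_fun setT g ->
  locally_integrable setT (fun t => g t ^+ 2) -> locally_integrable setT g.
Proof.
move=> mg [mg2 _ ig]; split => //; first exact: openT.
move=> A AT cA; have mA := compact_measurable cA.
have i2 : mu.-integrable A (fun t => (g t ^+ 2)%:E).
  by apply/integrableP; split; [apply/measurable_EFinP; exact: measurable_funTS|exact: ig].
have i1 : mu.-integrable A (fun=> (1:R)%:E).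
  apply: (@continuous_compact_integrable R (fun=> 1)) => //.
  by apply: continuous_subspaceT => x; exact: cvg_cst.
have /integrableP[_] := integrableD (mA : @measurable _ (measurableTypeR R) A) i1 i2; apply: le_lt_trans.
apply: ge0_le_integral => //.
- by apply/measurable_EFinP; apply: measurableT_comp => //; exact: measurable_funTS.
- apply: measurableT_comp => //; apply: emeasurable_funD => //.
  by apply/measurable_EFinP; exact: measurable_funTS.
move=> x _ /=; rewrite lee_fin; apply: le_trans (ler_norm _).
have := sqr_ge0 (`|g x| - 1); rewrite sqrrB1 real_normK ?num_real//.
have := sqr_ge0 (g x); lra.
Qed.

Lemma ae_Rall (P : R -> Prop) :
  (forall N : nat, {ae mu, forall t : R, - N%:R < t < N%:R -> P t}) ->
  {ae mu, forall t, P t}.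
Proof.
move=> H; have := @ae_foralln _ _ _ mu (fun N t => - N%:R < t < N%:R -> P t) H.
apply: ae_imply => t; have := @truncnS_gt R `|t|; set N := (_.+1) => Nt.
by move=> /(_ N); rewrite -ltr_norml; apply.
Qed.

Lemma wderiv_spec u : H1loc u -> L2loc (wderiv u) /\ is_weak_derivative u (wderiv u).
Proof. by case=> _ _ /(xgetPex (fun=> 0)). Qed.

Lemma H1loc_primitive u i : H1loc u -> forall s t, s <= t ->
  u t 0 i - u s 0 i = \int[mu]_(x in `[s, t]) wderiv u x 0 i.
Proof.
move=> hu; have [Lg wg] := wderiv_spec hu.
apply: weak_derivative_primitive.
- move=> t; case: hu => cu _ _.
  by apply: (@continuous_comp _ _ _ u (fun M : 'rV[R]_n => M 0 i));
    [exact: cu|exact: coord_continuous].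
- by apply: locally_integrable_sqr; case: (Lg i).
- by move=> phi tphi; exact: wg.
Qed.

Lemma L2loc_itv (g : R -> 'rV[R]_n) i a b : L2loc g ->
  mu.-integrable `[a, b] (EFin \o (fun t => g t 0 i)).
Proof.
by move=> /(_ i)[m1 m2]; apply: locally_integrable_itv; exact: locally_integrable_sqr.
Qed.

Lemma H1loc_ac u i a b : H1loc u -> ac_on (fun t => u t 0 i) a b.
Proof.
move=> hu; apply: (ac_on_primitive_abs (L2loc_itv i a b (wderiv_spec hu).1)).
by move=> s t _ st _; exact: H1loc_primitive.
Qed.

Lemma ae_isDv u (g : R -> 'rV[R]_n) :
  (forall i : 'I_n, {ae mu, forall t : R, is_derive t 1 (fun s => u s 0 i) (g t 0 i)}) ->
  {ae mu, forall t, isDv t u (g t)}.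
Proof.
move=> H; exact: (filter_forall (ae_filter_ringOfSetsType mu) H).
Qed.

Lemma wderivP u : H1loc u -> {ae mu, forall t, isDv t u (wderiv u t)}.
Proof.
move=> hu; apply: ae_isDv => i; apply: ae_Rall => N.
apply: primitive_derive; first exact: L2loc_itv (wderiv_spec hu).1.
by move=> s t _ st _; exact: H1loc_primitive.
Qed.

(** The weak derivative is taken coordinatewise from the Borel derivative
[dquot], so that no choice of representatives on null sets is needed. *)
Lemma ac_H1loc w (q : R -> R) : (forall i a b, a <= b -> ac_on (fun t => w t 0 i) a b) ->
  locally_integrable setT q ->
  {ae mu, forall t g, isDv t w g -> dot g g <= q t} -> H1loc w.
Proof.
move=> aw lq wq.
have cwi i : continuous (fun t => w t 0 i).
  move=> t; apply: (@ac_on_continuous _ _ (t - 1) (t + 1)); first by apply/andP; split; lra.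
  by apply: aw; lra.
have cw : continuous w by move=> t; apply: cvg_row => i; exact: cwi.
pose g t : 'rV[R]_n := \row_i dquot (fun s => w s 0 i) t.
have gE i : (fun t => g t 0 i) = dquot (fun s => w s 0 i) by apply/funext => t; rewrite mxE.
have mg i : measurable_fun setT (fun t => g t 0 i) by rewrite gE; exact: measurable_dquot.
have dg i : {ae mu, forall t : R, is_derive t 1 (fun s => w s 0 i) (g t 0 i)}.
  apply: ae_Rall => N; have NN : - N%:R <= N%:R :> R by rewrite (@le_trans _ _ 0)// oppr_le0.
  apply: ae_imply (ac_on_ae_derivable NN (aw i _ _ NN)) => t H /H dw.
  rewrite mxE; have := isD_derive1 dw => dw'; by rewrite (is_derive_dquot dw').
have dgv := ae_isDv dg.
split => //.
  move=> i; split; first exact: continuous_measurable_fun.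
  have c2 : continuous (fun t => w t 0 i ^+ 2) by move=> t; apply: cvgM; exact: cwi.
  split; [exact: continuous_measurable_fun|exact: openT|move=> A _ cA].
  have := @continuous_compact_integrable R (fun t => w t 0 i ^+ 2) A cA (continuous_subspaceT c2).
  by case/integrableP.
exists g; split; last first.
  move=> phi i tphi; exact: (ac_weak_derivative (aw i) (mg i) (dg i) tphi).
move=> i; split => //; case: lq => mq _ iq.
have m2 : measurable_fun setT (fun t => g t 0 i ^+ 2) by exact: measurable_funX.
split => //; first exact: openT.
move=> A AT cA; have mA := compact_measurable cA.
apply: le_lt_trans (iq A AT cA).
apply: ae_ge0_le_integral => //.
- by apply/measurable_EFinP; apply: measurableT_comp => //; exact: measurable_funTS.
- by apply/measurable_EFinP; apply: measurableT_comp => //; exact: measurable_funTS.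
apply: ae_imply2 wq dgv => t H /H qt _; rewrite lee_fin ger0_norm ?sqr_ge0//.
apply: le_trans (ler_norm _); apply: le_trans qt; exact: sqr_coord_le_dot.
Qed.

End h1loc.

(** * Lipschitz dependence of the retraction on a ball *)
Section retraction.
Context {R : realType} {n : nat}.
Implicit Types (x y : 'rV[R]_n) (e f : R).

Definition retract e x := if e < enorm x then (e / enorm x) *: x else x.

Lemma retract_out_in e f x y : 0 < e -> e < enorm x -> enorm y <= f ->
  enorm ((e / enorm x) *: x - y) <= 2 * enorm (x - y) + `|e - f|.
Proof.
move=> e0 ex yf; have x0 : 0 < enorm x by exact: lt_trans ex.
have -> : (e / enorm x) *: x - y = (e / enorm x - 1) *: x + (x - y).
  by rewrite scalerBl scale1r addrA subrK.
apply: le_trans (enormD _ _) _; rewrite enormZ.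
rewrite ler0_norm; last by rewrite subr_le0 ler_pdivrMr// mul1r ltW.
have -> : - (e / enorm x - 1) * enorm x = enorm x - e by field; rewrite gt_eqF.
have := le_trans (ler_norm _) (enorm_dist x y).
have := ler_norm (f - e); rewrite distrC; lra.
Qed.

(** Outside the balls the directions of x and y differ by at most
2 |x - y| / |x|; and a point outside its ball is moved by no more than its
distance to the other point, up to the difference of the radii. *)
Lemma retract_lipschitz e f x y : 0 < e -> 0 < f ->
  enorm (retract e x - retract f y) <= 2 * enorm (x - y) + `|e - f|.
Proof.
move=> e0 f0; rewrite /retract; case: ltP => ex; case: ltP => fy.
- have x0 : 0 < enorm x by exact: lt_trans ex.
  have y0 : 0 < enorm y by exact: lt_trans fy.
  have -> : (e / enorm x) *: x - (f / enorm y) *: y =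
      (e / enorm x) *: ((x - y) + (1 - enorm x / enorm y) *: y) + ((e - f) / enorm y) *: y.
    rewrite !scalerDr !scalerN -!scalerA !scalerA.
    apply/rowP => i; rewrite !mxE; field; by rewrite !gt_eqF.
  apply: le_trans (enormD _ _) _; apply: lerD; last first.
    by rewrite enormZ normrM normfV (gtr0_norm y0) -mulrA mulVf ?gt_eqF// mulr1.
  rewrite enormZ ger0_norm; last by rewrite divr_ge0 ?ltW.
  apply: (@le_trans _ _ (enorm ((x - y) + (1 - enorm x / enorm y) *: y))).
    by rewrite ler_piMl ?enorm_ge0// ler_pdivrMr// mul1r ltW.
  apply: le_trans (enormD _ _) _; rewrite enormZ.
  have -> : `|1 - enorm x / enorm y| * enorm y = `|enorm y - enorm x|.
    rewrite -{2}(gtr0_norm y0) -normrM; congr `|_|; field; by rewrite gt_eqF.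
  have := enorm_dist x y; rewrite distrC; lra.
- exact: retract_out_in.
- rewrite -enormN opprB -(enormN (x - y)) opprB distrC; exact: retract_out_in.
- have := normr_ge0 (e - f); have := enorm_ge0 (x - y); lra.
Qed.

End retraction.


(** * The calibration *)
Section calibration.
Context {R : realType} {n : nat}.
Variables (W : 'rV[R]_n -> R) (a : 'rV[R]_n) (r c0 c p M lam eps s0 : R) (E : R -> R).

Local Notation mu := (envelope_rate c p).
(* With E' = - mu E^(p / 2), the derivative of B E^q is - B q mu E^2 exactly
   for q = 3 - p / 2, and B is then chosen to have - (mu^2 / 2 + M) E^2. *)
Definition reserve_exponent := 3 - p / 2.
Definition reserve_factor := (mu ^+ 2 / 2 + M) / (reserve_exponent * mu).
Definition slope (s : R) := - mu * E s `^ (p / 2).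
Definition reserve (s : R) := reserve_factor * E s `^ reserve_exponent.
Definition calib (s rho : R) :=
  Num.max (slope s * Num.max (rho - E s) 0) (Num.min (reserve s) (lam * (rho - r / 2))).

Hypotheses (HW : has_continuous_partials W) (W0 : forall x, 0 <= W x).
Hypotheses (Wrad : radially_monotone_near W a r c0 p).
Hypotheses (WM : forall y, enorm y <= 1 -> W (a + y) <= M * enorm y ^+ 2).
Hypotheses (r0 : 0 < r) (cp : 0 < c) (cc : c < c0) (p2 : 2 <= p) (p6 : p < 6) (M0 : 0 < M).
Hypotheses (e0 : 0 < eps) (e1 : eps < 1) (er : eps < r / 8).
Hypotheses (lam0 : 0 < lam) (mlam : mu * eps <= lam).
Hypotheses (Klam : reserve_factor * eps `^ reserve_exponent < lam * (r / 2)).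
Hypotheses (Wlam : lam ^+ 2 / 2 + (mu ^+ 2 / 2 + M) * eps ^+ 2 <= c0 * (r / 8) `^ (p - 1) * (r / 8)).
Hypotheses (envE : envelope c p eps s0 E).

Lemma envelope_rate_gt0 : 0 < mu.
Proof. by rewrite /envelope_rate sqrtr_gt0 divr_gt0// ?mulr_gt0//; move: p2; lra. Qed.

Lemma sqr_envelope_rate : mu ^+ 2 = 2 * c / p.
Proof. by rewrite sqr_sqrtr// divr_ge0 ?mulr_ge0//; move: p2 cp; lra. Qed.

Lemma reserve_exponent_gt0 : 0 < reserve_exponent.
Proof. by rewrite /reserve_exponent; move: p6; lra. Qed.

Lemma reserve_factor_gt0 : 0 < reserve_factor.
Proof.
by rewrite divr_gt0// ?mulr_gt0 ?reserve_exponent_gt0 ?envelope_rate_gt0// ltr_pwDr// divr_ge0// sqr_ge0.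
Qed.

Let E_gt0 s : s0 <= s -> 0 < E s. Proof. exact: envelope_gt0 envE s. Qed.
Let E_le s : s0 <= s -> E s <= eps. Proof. exact: envelope_le envE s. Qed.
Let isD_E s : s0 < s -> is_derive s 1 E (slope s). Proof. exact: envelope_derive envE s. Qed.

Let pow_envelope_le s q : s0 <= s -> 1 <= q -> E s `^ q <= E s.
Proof.
move=> ss q1; apply: ge1r_powR => //; rewrite E_gt0//.
by apply: le_trans (E_le ss) _; exact: ltW.
Qed.

Lemma slope_le0 s : slope s <= 0.
Proof. by rewrite /slope mulNr oppr_le0 mulr_ge0 ?powR_ge0// ltW// envelope_rate_gt0. Qed.

Lemma slope_lt0 s : s0 <= s -> slope s < 0.
Proof. by move=> ss; rewrite /slope mulNr oppr_lt0 mulr_gt0 ?powR_gt0 ?E_gt0// envelope_rate_gt0. Qed.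

Lemma slope_ge s : s0 <= s -> - (mu * E s) <= slope s.
Proof.
move=> ss; rewrite /slope mulNr lerN2 ler_pM2l ?envelope_rate_gt0//.
by apply: pow_envelope_le => //; move: p2; lra.
Qed.

Lemma sqr_slope_le s : s0 <= s -> slope s ^+ 2 <= mu ^+ 2 * E s ^+ 2.
Proof.
move=> ss; have := slope_ge ss; have := slope_le0 s; rewrite -exprMn => h1 h2.
have h3 : 0 < mu * E s by rewrite mulr_gt0 ?envelope_rate_gt0 ?E_gt0.
by rewrite -sqrrN ler_sqr ?nnegrE ?(ltW h3) ?oppr_ge0// lerNl.
Qed.

Lemma isD_slope s : s0 < s -> is_derive s 1 slope (c * E s `^ (p - 1)).
Proof.
move=> ss; have Es := E_gt0 (ltW ss).
have := isD_scale (- mu)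
  (@isD_comp _ (fun u => u `^ (p / 2)) E s _ _ (is_derive1_powR (p / 2) Es) (isD_E ss)).
move/isD_eq; apply; rewrite /slope.
have -> : p - 1 = (p / 2 - 1) + p / 2 by field.
rewrite (@powRD _ _ (p / 2 - 1) (p / 2)); last by rewrite [E s == 0]gt_eqF// implybT.
have cE : c = mu ^+ 2 * (p / 2) by rewrite sqr_envelope_rate; field; rewrite gt_eqF//; move: p2; lra.
by rewrite [X in _ = X * _]cE; ring.
Qed.

Lemma isD_reserve s : s0 < s -> is_derive s 1 reserve (- (mu ^+ 2 / 2 + M) * E s ^+ 2).
Proof.
move=> ss; have Es := E_gt0 (ltW ss).
have := isD_scale reserve_factor
  (@isD_comp _ (fun u => u `^ reserve_exponent) E s _ _ (is_derive1_powR reserve_exponent Es) (isD_E ss)).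
move/isD_eq; apply; rewrite /slope.
have -> : E s ^+ 2 = E s `^ (reserve_exponent - 1) * E s `^ (p / 2).
  rewrite -powRD; last by rewrite [E s == 0]gt_eqF// implybT.
  have -> : reserve_exponent - 1 + p / 2 = 2%:R by rewrite /reserve_exponent; field.
  by rewrite powR_mulrn// ltW.
by rewrite /reserve_factor; field; rewrite !gt_eqF ?envelope_rate_gt0 ?reserve_exponent_gt0.
Qed.

Lemma reserve_gt0 s : s0 <= s -> 0 < reserve s.
Proof. by move=> ss; rewrite mulr_gt0 ?reserve_factor_gt0//; exact/powR_gt0/E_gt0. Qed.

Lemma reserve_lt s : s0 <= s -> reserve s < lam * (r / 2).
Proof.
move=> ss; apply: le_lt_trans Klam; rewrite ler_pM2l ?reserve_factor_gt0//.
by apply: ge0_ler_powR; [exact/ltW/reserve_exponent_gt0|rewrite nnegrE ltW// E_gt0|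
  rewrite nnegrE ltW|exact: E_le].
Qed.

Section pointwise.
Variables (v w : R -> 'rV[R]_n) (t : R) (g gw : 'rV[R]_n) (d : R).
Hypotheses (ts : s0 < t) (wE : forall s, w s = projP a s0 E v s).
Hypotheses (vg : isDv t v g) (wg : isDv t w gw).
Let x s := v s - a.
Let rho s := enorm (x s).
Let xg : isDv t x g. Proof. exact: isDv_sub_cst. Qed.
Let nts : \forall s \near t, s0 < s. Proof. exact: lt_nbhsr. Qed.
Let crho : {for t, continuous rho}. Proof. exact: isDv_enorm_continuous xg. Qed.
Let cEt : {for t, continuous E}. Proof. exact: isD_continuous (isD_E ts). Qed.

Let near_lt (f h : R -> R) : {for t, continuous f} -> {for t, continuous h} ->
  f t < h t -> \forall s \near t, f s < h s.
Proof.
move=> cf ch fh; have cd : {for t, continuous (fun s => h s - f s)} by apply: cvgB.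
have fh0 : 0 < h t - f t by rewrite subr_gt0.
have Hn := (@cvgrPdist_lt _ _ _ (nbhs t) (nbhs_filter t) _ _).1 cd _ fh0.
by apply: filterS Hn => s; rewrite ltr_norml => /andP[_]; lra.
Qed.

Let vE : W (v t) = W (a + x t). Proof. by rewrite /x addrC subrK. Qed.

Lemma projection_inside : rho t <= E t -> w t = v t /\ gw = g.
Proof.
move=> rE; have Et := E_le (ltW ts).
have wv : w t = v t by rewrite wE /projP ts/= ltNge rE.
split => //; move: rE; rewrite le_eqVlt => /predU1P[rE|rE].
  pose l s := if E s < rho s then 1 - E s / rho s else 0.
  apply: (projection_contact (l := l) vg wg (x := x) (a := a)) => //.
    by rewrite -/(rho t) rE E_gt0// ltW.
  near=> s; have ss : s0 < s by near: s; exact: nts.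
  rewrite /l wE /projP ss /=; case: ltP => [Er|_]; last by rewrite lexx subrr scale0r.
  have rp : 0 < rho s by exact: lt_trans (E_gt0 (ltW ss)) Er.
  rewrite subr_ge0 ler_pdivrMr// mul1r ltW//; split => //.
  by rewrite -/(x s) scalerBl scale1r -/(rho s) opprD addrA.
have n2 : \forall s \near t, v s = w s.
  have : \forall s \near t, rho s < E s by exact: near_lt.
  by apply: filterS => s h; rewrite wE /projP [E s < _]ltNge (ltW h) andbF.
exact: isDv_unique wg (isDv_near n2 vg).
Unshelve. all: by end_near. Qed.

Lemma projection_outside : E t < rho t ->
  dot gw gw <= dot g g - (dot (x t) g / rho t) ^+ 2 + slope t ^+ 2.
Proof.
move=> Er; have Ep := E_gt0 (ltW ts).
apply: (projection_speed (w := w) xg wg (isD_E ts) Ep Er).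
have n1 : \forall s \near t, E s < rho s by exact: near_lt.
by near=> s; rewrite wE /projP ifT//; apply/andP; split; near: s.
Unshelve. all: by end_near. Qed.

Lemma projection_speed_bound : dot gw gw <= dot g g + mu ^+ 2.
Proof.
have [h|h] := leP (rho t) (E t).
  by have [_ ->] := projection_inside h; rewrite lerDl sqr_ge0.
have := projection_outside h; have := sqr_ge0 (dot (x t) g / rho t).
have := sqr_slope_le (ltW ts).
have : mu ^+ 2 * E t ^+ 2 <= mu ^+ 2.
  rewrite ler_piMr ?sqr_ge0// exprn_ile1 ?(ltW (E_gt0 (ltW ts)))//.
  by apply: le_trans (E_le (ltW ts)) _; exact: ltW.
lra.
Qed.

Hypotheses (dpsi : is_derive t 1 (fun s => calib s (rho s)) d).

(** Near such a time the calibration is nonpositive, and it vanishes at it. *)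
Lemma calib_inside : rho t <= E t -> d = 0.
Proof.
move=> rE; have Et := E_le (ltW ts).
have n1 : \forall s \near t, rho s < r / 2.
  apply: near_lt => //; first exact: cvg_cst.
  by move: er r0; lra.
have c0' : calib t (rho t) = 0.
  rewrite /calib (_ : Num.max (rho t - E t) 0 = 0) ?mulr0; last first.
    by apply/max_r; rewrite subr_le0.
  apply/max_l; rewrite ge_min; apply/orP; right.
  by rewrite pmulr_rle0//; have := nbhs_singleton n1; lra.
apply: (@isD_touch _ (fun s => calib s (rho s)) (fun=> 0) t _ _ _ c0' dpsi (isD_cst 0 t)).
apply: filterS n1 => s rs; rewrite /calib ge_max ge_min mulr_le0_ge0 ?slope_le0 ?le_max ?lexx ?orbT//=.
by apply/orP; right; rewrite pmulr_rle0//; lra.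
Unshelve. all: by end_near. Qed.

(** Each branch is a subsolution in the region where it is the active one. *)
Lemma calib_outside : E t < rho t ->
  d <= (dot (x t) g / rho t) ^+ 2 / 2 - slope t ^+ 2 / 2 + W (v t) - W (w t).
Proof.
move=> Er; have Ep := E_gt0 (ltW ts); have rp : 0 < rho t by exact: lt_trans Er.
have Ee := E_le (ltW ts).
have wt : w t = a + E t *: ((rho t)^-1 *: x t).
  by rewrite wE /projP ts Er/= scalerA.
have dr := isD_enorm xg rp; rewrite -/(rho t) in dr.
set r' := dot (x t) g / rho t in dr *.
pose f1 s := slope s * Num.max (rho s - E s) 0.
pose f3 s := lam * (rho s - r / 2).
have d1 : is_derive t 1 f1 (slope t * (r' - slope t) + (rho t - E t) * (c * E t `^ (p - 1))).
  apply: isD_near (isD_mul (isD_slope ts) (isD_sub dr (isD_E ts))).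
  have : \forall s \near t, E s < rho s by exact: near_lt.
  by apply: filterS => s h; rewrite /f1 max_l// subr_ge0 ltW.
have d3 : is_derive t 1 f3 (lam * r').
  by apply: isD_eq (isD_scale lam (isD_sub dr (isD_cst (r / 2) t))) _; rewrite subr0.
have d2 := isD_reserve ts.
have c1 := isD_continuous d1; have c2 := isD_continuous d2; have c3 := isD_continuous d3.
have f1t : f1 t = slope t * (rho t - E t) by rewrite /f1 max_l// subr_ge0 ltW.
have E1n := slope_lt0 (ltW ts).
have Kp := reserve_gt0 (ltW ts); have Kl := reserve_lt (ltW ts).
have sE1 := sqr_slope_le (ltW ts).
set th := (rho t)^-1 *: x t in wt.
have th1 : enorm th = 1 by rewrite enormZ gtr0_norm ?invr_gt0// -/(rho t) mulVf// gt_eqF.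
have vt : W (v t) = W (a + rho t *: th).
  by rewrite vE /th scalerA divff ?scale1r// gt_eqF.
have wM : W (w t) <= M * E t ^+ 2.
  have := WM (y := E t *: th); rewrite enormZ th1 mulr1 gtr0_norm// -wt; apply.
  by apply: le_trans Ee _; exact: ltW.
have c00 : 0 <= c0 by move: cp cc; lra.
have p1 : 1 <= p by move: p2; lra.
have gap s u := @radial_gap _ _ W a r c0 p s u th HW Wrad c00 p1 th1.
have Epow0 := powR_ge0 (E t) (p - 1).
(* First branch: it is negative, which forces rho < r / 2. *)
have [h|h] := leP (Num.min (reserve t) (f3 t)) (f1 t).
  have -> : d = slope t * (r' - slope t) + (rho t - E t) * (c * E t `^ (p - 1)).
    apply/esym; apply: (@isD_touch _ f1 (fun s => calib s (rho s)) t _ _ _ _ d1 dpsi).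
      by exists 1 => //= s _; rewrite /calib le_max lexx.
    by rewrite /calib -/(f1 t) -/(f3 t) max_l.
  have f10 : f1 t < 0 by rewrite f1t nmulr_rlt0// subr_gt0.
  have rr : rho t < r.
    move: h; rewrite ge_min => /orP[h|h]; first by have := lt_trans Kp (le_lt_trans h f10); rewrite ltxx.
    have : f3 t < 0 by exact: le_lt_trans f10.
    by rewrite /f3 pmulr_rlt0//; move: r0; lra.
  have := gap _ _ (ltW Ep) (ltW Er) rr; rewrite -vt -wt.
  have : c * E t `^ (p - 1) * (rho t - E t) <= c0 * E t `^ (p - 1) * (rho t - E t).
    by rewrite ler_wpM2r ?subr_ge0 ?(ltW Er)// ler_wpM2r// ltW.
  have := sqr_ge0 (r' - slope t); nra.
have n12 : \forall s \near t, f1 s < Num.min (reserve s) (f3 s).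
  apply: near_lt => //; apply: continuous_min => //.
have minE : calib t (rho t) = Num.min (reserve t) (f3 t).
  by rewrite /calib -/(f1 t) -/(f3 t) max_r// ltW.
have W0t := W0 (v t).
(* Second branch: the reserve pays for the radial motion of w. *)
have [h3|h3] := leP (reserve t) (f3 t).
  have -> : d = - (mu ^+ 2 / 2 + M) * E t ^+ 2.
    apply: (@isD_touch _ (fun s => calib s (rho s)) reserve t _ _ _ _ dpsi d2); last by rewrite minE min_l.
    apply: filterS n12 => s h12; rewrite /calib (max_r (ltW h12)).
    by rewrite ge_min lexx.
  have := sqr_ge0 r'; nra.
(* Third branch: being below the reserve and above the first branch forces
   r / 4 <= rho < r. *)
have -> : d = lam * r'.
  apply: (@isD_touch _ (fun s => calib s (rho s)) f3 t _ _ _ _ dpsi d3); last by rewrite minE min_r// ltW.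
  apply: filterS n12 => s h12; rewrite /calib (max_r (ltW h12)).
  by rewrite ge_min lexx orbT.
have rr : rho t < r.
  by have := lt_trans h3 Kl; rewrite /f3 ltr_pM2l//; lra.
have r4 : r / 4 <= rho t.
  rewrite leNgt; apply/negP => r4.
  move: h; rewrite lt_min => /andP[_]; apply/negP; rewrite -leNgt f1t /f3.
  have := slope_ge (ltW ts); have : mu * E t <= lam.
    by apply: le_trans mlam; rewrite ler_pM2l ?envelope_rate_gt0.
  move: lam0 => l0 h5 h6.
  have : - lam * (rho t - E t) <= slope t * (rho t - E t).
    by rewrite ler_pM2r ?subr_gt0//; lra.
  apply: le_trans; rewrite mulNr -mulrN ler_pM2l//.
  by lra.
have r8 : 0 <= r / 8 by move: r0; lra.
have r8' : r / 8 <= rho t by move: r0; lra.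
have := gap _ _ r8 r8' rr; rewrite -vt => G.
have W08 := W0 (a + (r / 8) *: th).
have : c0 * (r / 8) `^ (p - 1) * (r / 8) <= c0 * (r / 8) `^ (p - 1) * (rho t - r / 8).
  by apply: ler_wpM2l; [rewrite mulr_ge0// powR_ge0|lra].
have EE : E t ^+ 2 <= eps ^+ 2 by rewrite ler_sqr ?nnegrE// ltW.
have : (mu ^+ 2 / 2 + M) * E t ^+ 2 <= (mu ^+ 2 / 2 + M) * eps ^+ 2.
  by apply: ler_wpM2l => //; rewrite addr_ge0 ?divr_ge0 ?sqr_ge0// ltW.
have := sqr_ge0 (r' - lam); move: Wlam; nra.
Unshelve. all: by end_near. Qed.

Lemma calib_pointwise :
  dot gw gw / 2 + W (w t) + d <= dot g g / 2 + W (v t).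
Proof.
have [h|h] := leP (rho t) (E t).
  by have [-> ->] := projection_inside h; rewrite (calib_inside h) addr0.
have := projection_outside h; have := calib_outside h; lra.
Qed.

End pointwise.

(** * Comparison of the energies *)
Section comparison.
Variables (v : R -> 'rV[R]_n).
Hypotheses (hv : H1loc v) (hs : eball a eps (v s0)).
Local Notation lmu := (@lebesgue_measure R).
Local Notation w := (projP a s0 E v).
Let rho s := enorm (v s - a).

(** Moving the initial time from s0 to s1 avoids the differentiability of the
envelope at s0, where it is only known to be continuous from the right. *)
Lemma projection_start : exists2 s1, s0 < s1 & forall s, s0 <= s -> s <= s1 -> rho s < E s.
Proof.
have [cv _ _] := hv; have [_ cE _ Es0 _] := envE.
have r0' : 0 < (eps - rho s0) / 2 by rewrite divr_gt0// subr_gt0; exact: hs.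
have crho : {for s0, continuous rho}.
  apply: (@continuous_comp _ _ _ (fun s => v s - a) (@enorm R n)); last exact: enorm_continuous.
  by apply: cvgB; [exact: cv|exact: cvg_cst].
have H1 := (@cvgrPdist_lt _ _ _ (nbhs s0) (nbhs_filter s0) _ _).1 crho _ r0'.
have s0in : `[s0, +oo[%classic s0 by rewrite /= in_itv/= lexx.
have H2 : \forall s \near s0, `[s0, +oo[%classic s -> `|E s0 - E s| < (eps - rho s0) / 2.
  have /subspace_continuousP/(_ s0 s0in) := cE.
  by move=> /cvgrPdist_lt/(_ _ r0').
have [e /= ep He] : \forall s \near s0, `|rho s0 - rho s| < (eps - rho s0) / 2 /\
    (`[s0, +oo[%classic s -> `|E s0 - E s| < (eps - rho s0) / 2).
  by near=> s; split; near: s.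
exists (s0 + e / 2); first by rewrite ltrDl divr_gt0.
move=> s ss se; have [|h1 h2] := He s.
  by rewrite /= distrC ger0_norm ?subr_ge0//; move: ep; lra.
have := h2 _; rewrite /= in_itv/= andbT ss => /(_ isT).
by move: h1; rewrite Es0 !ltr_norml; lra.
Unshelve. all: by end_near. Qed.

Variable s1 : R.
Hypotheses (s01 : s0 < s1) (inside : forall s, s0 <= s -> s <= s1 -> rho s < E s).

Lemma projection_before s : s <= s1 -> w s = v s.
Proof.
move=> ss; rewrite /projP; case: ifP => // /andP[s0s].
by rewrite ltNge (ltW (inside (ltW s0s) ss)).
Qed.

Lemma projection_after s : s1 <= s -> w s = a + retract (E s) (v s - a).
Proof.
move=> ss; rewrite /projP (lt_le_trans s01 ss)/= /retract.
by case: ifP => // _; rewrite [RHS]addrC subrK.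
Qed.

Let s1_gt s : s1 <= s -> s0 < s. Proof. exact: lt_le_trans. Qed.

Lemma envelope_le1 s : s1 <= s -> E s <= 1.
Proof. by move=> /s1_gt/ltW/E_le/le_trans; apply; exact: ltW. Qed.

Lemma norm_slope_le s : s1 <= s -> `|slope s| <= mu.
Proof.
move=> ss; rewrite ler0_norm ?slope_le0//; have := slope_ge (ltW (s1_gt ss)).
have : mu * E s <= mu by rewrite ler_piMr ?envelope_le1// ltW// envelope_rate_gt0.
lra.
Qed.

Lemma ac_envelope b b' : s1 <= b -> ac_on E b b'.
Proof.
move=> sb; apply: (@ac_on_derivable R E slope mu b b') => s /andP[/(le_trans sb) ss _].
  exact: isD_E (s1_gt ss).
exact: norm_slope_le.
Qed.

Lemma ac_slope b b' : s1 <= b -> ac_on slope b b'.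
Proof.
move=> sb;
apply: (@ac_on_derivable R slope (fun s => c * E s `^ (p - 1)) c b b') => s /andP[/(le_trans sb) ss _].
  exact: isD_slope (s1_gt ss).
rewrite ger0_norm ?mulr_ge0 ?powR_ge0 ?(ltW cp)// ler_piMr ?(ltW cp)//.
apply: le_trans (envelope_le1 ss); apply: pow_envelope_le; first exact: ltW (s1_gt ss).
by move: p2; lra.
Qed.

Lemma ac_reserve b b' : s1 <= b -> ac_on reserve b b'.
Proof.
move=> sb;
apply: (@ac_on_derivable R reserve (fun s => - (mu ^+ 2 / 2 + M) * E s ^+ 2) (mu ^+ 2 / 2 + M) b b')
  => s /andP[/(le_trans sb) ss _].
  exact: isD_reserve (s1_gt ss).
have h : 0 <= mu ^+ 2 / 2 + M by rewrite addr_ge0 ?divr_ge0 ?sqr_ge0// ltW.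
have hE : 0 <= (mu ^+ 2 / 2 + M) * E s ^+ 2 by rewrite mulr_ge0// sqr_ge0.
rewrite mulNr normrN (ger0_norm hE) ler_piMr// exprn_ile1 ?envelope_le1//.
exact/ltW/E_gt0/ltW/s1_gt.
Qed.

Lemma ac_rho b b' : ac_on rho b b'.
Proof.
apply: (@ac_on_comb R 'I_n (fun i s => v s 0 i) (fun=> 1)) => // [i|s t _ _ _].
  exact: H1loc_ac.
apply: le_trans (enorm_dist _ _) _; rewrite opprB addrA subrK.
apply: le_trans (enorm_le_sum _) _; apply: ler_sum => i _.
by rewrite mul1r !mxE.
Qed.

Lemma ac_calib T : s1 <= T -> ac_on (fun s => calib s (rho s)) s1 T.
Proof.
move=> sT; apply: ac_on_max; last first.
  apply: ac_on_min; first exact: ac_reserve.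
  apply: (ac_on_comp1 (ltW lam0) (ac_rho s1 T)) => s t _ _ _.
  by rewrite -mulrBr normrM (gtr0_norm lam0) opprB addrA subrK.
have aD : ac_on (fun s => Num.max (rho s - E s) 0) s1 T.
  apply: ac_on_max; first by apply: ac_on_sub2; [exact: ac_rho|exact: ac_envelope].
  by apply: (@ac_on_lipschitz _ _ 0) => s t _ _ _; rewrite subrr normr0 mul0r.
have [C CP] := ac_on_bounded sT aD.
apply: (@ac_on_mul _ _ _ (Num.max mu C)) => //; last exact: ac_slope.
  by move=> s /andP[ss _]; rewrite le_max norm_slope_le.
by move=> s sT'; rewrite le_max CP// orbT.
Qed.

(** Before s1 the curve is v; after s1 the retraction on the ball of radius E
is Lipschitz in the point and in the radius. *)
Lemma ac_projection i b b' : b <= b' -> ac_on (fun s => w s 0 i) b b'.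
Proof.
have before x y : y <= s1 -> ac_on (fun s => w s 0 i) x y.
  move=> ys; apply: (ac_on_comp1 ler01 (H1loc_ac i x y hv)) => s t _ st ty.
  by rewrite !projection_before ?mul1r// ?(le_trans st) // (le_trans ty).
have after x y : s1 <= x -> ac_on (fun s => w s 0 i) x y.
  move=> sx.
  apply: (@ac_on_comb R ('I_n + unit)%type (fun j s => if j is inl k then v s 0 k else E s)
    (fun j => if j is inl k then 2 else 1)).
  - by case.
  - by case=> [k|[]]; [exact: H1loc_ac|exact: ac_envelope].
  move=> s t xs st ty; rewrite big_sumType/= -mulr_sumr big_const card_unit/= addr0 mul1r.
  have ss := le_trans sx xs; have ts := le_trans ss st.
  have -> : w t 0 i - w s 0 i = (retract (E t) (v t - a) - retract (E s) (v s - a)) 0 i.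
    by rewrite !projection_after// !mxE; ring.
  apply: le_trans (coord_le_enorm _ _) _.
  apply: le_trans (retract_lipschitz _ _ (E_gt0 (ltW (s1_gt ts))) (E_gt0 (ltW (s1_gt ss)))) _.
  rewrite opprB addrA subrK lerD2r ler_pM2l//.
  apply: le_trans (enorm_le_sum _) _; apply: ler_sum => k _; by rewrite !mxE.
move=> bb; have [b's|sb'] := leP b' s1; first exact: before.
have [sb|bs] := leP s1 b; first exact: after.
exact: (ac_on_glue (ltW bs) (ltW sb') (before _ _ (lexx _)) (after _ _ (lexx _))).
Qed.

Lemma locally_integrable_speed (u : R -> 'rV[R]_n) : H1loc u ->
  locally_integrable setT (fun t => dot (wderiv u t) (wderiv u t)).
Proof.
move=> hu; have [Lg _] := wderiv_spec hu; rewrite /dot.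
have lc (k : R) : locally_integrable setT (fun=> k : R).
  split; [exact: measurable_cst|exact: openT|move=> A _ cA].
  have ck : {within A, continuous (fun=> k : R)}.
    by apply: continuous_subspaceT => x; exact: cvg_cst.
  by have /integrableP[_] := continuous_compact_integrable cA ck.
elim: (index_enum _) => [|i s IH].
  by under eq_fun do rewrite big_nil; exact: lc.
under eq_fun do rewrite big_cons.
by apply: (locally_integrableD (Lg i).2 IH).
Qed.

Lemma projection_H1loc : H1loc w.
Proof.
apply: (@ac_H1loc _ _ _ (fun t => dot (wderiv v t) (wderiv v t) + mu ^+ 2)).
- by move=> i b b' bb; exact: ac_projection.
- apply: (locally_integrableD (locally_integrable_speed hv)).
  split; [exact: measurable_cst|exact: openT|move=> A _ cA].
  have ck : {within A, continuous (fun=> mu ^+ 2 : R)}.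
    by apply: continuous_subspaceT => x; exact: cvg_cst.
  by have /integrableP[_] := continuous_compact_integrable cA ck.
apply: ae_imply2 (wderivP hv) (ae_neq s1) => t vg ts g wg.
have [h|h] := ltP t s1; last first.
  exact: (projection_speed_bound (s1_gt h) (fun s => erefl) vg wg).
have -> : g = wderiv v t.
  apply: (isDv_unique wg); apply: isDv_near vg.
  have : \forall s \near t, s < s1 by exact: lt_nbhsl.
  by apply: filterS => s ss; rewrite projection_before// ltW.
by rewrite lerDl sqr_ge0.
Qed.

Hypothesis cW : continuous W.

Definition edens (u : R -> 'rV[R]_n) (t : R) := 2^-1 * enorm (wderiv u t) ^+ 2 + W (u t).

Lemma edens_integrable (u : R -> 'rV[R]_n) b b' : H1loc u -> lmu.-integrable `[b, b'] (EFin \o edens u).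
Proof.
move=> hu; have cu : continuous u by case: hu.
have i1 := locally_integrable_itv b b' (locally_integrable_speed hu).
have cWu : continuous (fun t => W (u t)).
  by move=> t; apply: (@continuous_comp _ _ _ u W); [exact: cu|exact: cW].
have i2 := continuous_itv_integrable b b' cWu.
rewrite [X in lmu.-integrable _ X](_ : _ = (fun t => (2^-1)%:E *
   (EFin \o (fun t => dot (wderiv u t) (wderiv u t))) t + (EFin \o (fun t => W (u t))) t)%E).
  by apply: integrableD => //; exact: integrableZl.
by apply/funext => t /=; rewrite /edens sqr_enorm.
Qed.

Lemma edens_ge0 u t : 0 <= edens u t.
Proof. by rewrite /edens addr_ge0// mulr_ge0// sqr_ge0. Qed.

Lemma edens_before b : b <= s1 ->
  \int[lmu]_(t in `[b, s1]) edens w t = \int[lmu]_(t in `[b, s1]) edens v t.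
Proof.
move=> bs; have hw := projection_H1loc.
have mv : measurable_fun `[b, s1] (edens v).
  by apply/measurable_EFinP; case/integrableP : (edens_integrable b s1 hv).
apply: (ae_eq_integrable (measurable_itv _) mv _ (edens_integrable b s1 hw)).2.
apply: ae_itv; apply: ae_imply2 (wderivP hv) (wderivP hw) => t vg wg /andP[_ ts].
have gE : wderiv w t = wderiv v t.
  apply: (isDv_unique wg); apply: isDv_near vg.
  have : \forall s \near t, s < s1 by exact: lt_nbhsl.
  by apply: filterS => s ss; rewrite projection_before// ltW.
by rewrite /edens gE projection_before// ltW.
Qed.

(** Integrate the pointwise inequality. The calibration vanishes at s1, and at T
it is nonnegative unless rho < r / 2, where it is at least E' r / 2. *)
Lemma edens_after T : s1 <= T ->
  \int[lmu]_(t in `[s1, T]) edens w t <=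
  \int[lmu]_(t in `[s1, T]) edens v t + mu * E T * (r / 2).
Proof.
move=> sT; have hw := projection_H1loc.
have iv := edens_integrable s1 T hv; have iw := edens_integrable s1 T hw.
have ie : lmu.-integrable `[s1, T] (EFin \o (fun t => edens v t - edens w t)).
  rewrite [X in lmu.-integrable _ X](_ : _ = (fun t => (EFin \o edens v) t - (EFin \o edens w) t)%E)//.
  exact: integrableB.
have : calib T (rho T) - calib s1 (rho s1) <= \int[lmu]_(t in `[s1, T]) (edens v t - edens w t).
  apply: (ac_on_le sT (ac_calib sT) ie).
  apply: ae_imply2 (wderivP hv) (wderivP hw) => t vg wg /andP[st _] d dd.
  have := calib_pointwise (lt_trans s01 st) (fun s => erefl) vg wg dd.
  rewrite /edens !sqr_enorm; lra.
rewrite RintegralB//.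
have Es1 := E_le (ltW s01); have rE1 := inside (ltW s01) (lexx s1).
have -> : calib s1 (rho s1) = 0.
  rewrite /calib (max_r (_ : rho s1 - E s1 <= 0)) ?subr_le0 ?(ltW rE1)// mulr0.
  apply/max_l; rewrite ge_min; apply/orP; right; rewrite pmulr_rle0//.
  by move: er r0; lra.
have : - (mu * E T * (r / 2)) <= calib T (rho T).
  have ET := E_gt0 (ltW (s1_gt sT)).
  have mE : 0 <= mu * E T * (r / 2).
    by rewrite !mulr_ge0 ?(ltW envelope_rate_gt0) ?(ltW ET) ?divr_ge0// ltW.
  have [h|h] := leP (r / 2) (rho T).
    apply: (@le_trans _ _ 0); first by rewrite oppr_le0.
    rewrite /calib le_max; apply/orP; right; rewrite le_min (ltW (reserve_gt0 (ltW (s1_gt sT))))/=.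
    by rewrite mulr_ge0 ?subr_ge0// ltW.
  rewrite /calib le_max; apply/orP; left.
  have mx : Num.max (rho T - E T) 0 <= r / 2.
    by rewrite ge_max; apply/andP; split; move: r0; lra.
  have mx0 : 0 <= Num.max (rho T - E T) 0 by rewrite le_max lexx orbT.
  apply: (@le_trans _ _ (- (mu * E T) * Num.max (rho T - E T) 0)).
    by rewrite mulNr lerN2 ler_wpM2l// mulr_ge0 ?(ltW envelope_rate_gt0) ?(ltW ET).
  by rewrite ler_wpM2r// slope_ge// ltW// s1_gt.
lra.
Qed.

Lemma edens_between b T : b <= s1 -> s1 <= T ->
  \int[lmu]_(t in `[b, T]) edens w t <=
  \int[lmu]_(t in `[b, T]) edens v t + mu * E T * (r / 2).
Proof.
move=> bs sT; have hw := projection_H1loc.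
rewrite (Rintegral_cat bs sT (lexx T) (edens_integrable b T hv)).
rewrite (Rintegral_cat bs sT (lexx T) (edens_integrable b T hw)).
by rewrite edens_before// -addrA lerD2l edens_after.
Qed.

End comparison.

(** The error term of [edens_between] tends to 0 with the envelope. *)
Lemma projection_energy v : continuous W -> H1loc v -> eball a eps (v s0) ->
  H1loc (projP a s0 E v) /\ (energy W (projP a s0 E v) <= energy W v)%E.
Proof.
move=> cW hv hs; have [s1 s01 inside] := projection_start hv hs.
have hw := projection_H1loc hv s01 inside.
split => //; set w := projP a s0 E v in hw *.
have mE (u : R -> 'rV[R]_n) : H1loc u -> measurable_fun setT (edens u).
  move=> hu; have [ms _ _] := locally_integrable_speed hu.
  apply: measurable_funD.
    under eq_fun do rewrite sqr_enorm.
    by apply: measurable_funM => //; exact: measurable_cst.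
  apply: continuous_measurable_fun => t; apply: (@continuous_comp _ _ _ u W); last exact: cW.
  by case: hu => cu _ _; exact: cu.
pose F (N : nat) := `[- N%:R : R, N%:R]%classic.
have FT : \bigcup_N F N = setT.
  apply/seteqP; split => // t _; exists (Num.truncn `|t|).+1 => //.
  by rewrite /F/= in_itv/= -ler_norml ltW// truncnS_gt.
have cv : (\int[lebesgue_measure]_(t in F N) (edens w t)%:E @[N --> \oo] --> energy W w)%E.
  rewrite /energy -[in X in _ --> X]FT.
  apply: ge0_nondecreasing_set_cvg_integral.
  - apply/nondecreasing_seqP => N; rewrite subsetEset /F.
    by apply: subset_itv; rewrite bnd_simp ?lerN2 ler_nat.
  - by move=> N; exact: measurable_itv.
  - by move=> N; apply/measurable_EFinP; apply: measurable_funTS; exact: mE.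
  - by move=> N t _; rewrite lee_fin edens_ge0.
apply/lee_addgt0Pr => e e0'; apply: cvge_le cv.
have [_ _ _ _ E0] := envE.
have d0 : 0 < e / (mu * r) by rewrite divr_gt0// mulr_gt0// envelope_rate_gt0.
have [T [_ TP]] := (cvgrPdist_lt _ _).1 E0 _ d0.
near=> N.
have sN : s1 <= N%:R by rewrite ltW//; near: N; exact: nbhs_infty_gtr.
have bN : - N%:R <= s1 by rewrite lerNl ltW//; near: N; exact: nbhs_infty_gtr.
have TN : T < N%:R by near: N; exact: nbhs_infty_gtr.
have iv := edens_integrable cW (- N%:R) N%:R hv; have iw := edens_integrable cW (- N%:R) N%:R hw.
have fw : (\int[lebesgue_measure]_(t in F N) (edens w t)%:E)%E \is a fin_num.
  by apply: integrable_fin_num; [exact: measurable_itv|exact: iw].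
have fv : (\int[lebesgue_measure]_(t in F N) (edens v t)%:E)%E \is a fin_num.
  by apply: integrable_fin_num; [exact: measurable_itv|exact: iv].
rewrite -(fineK fw).
apply: (@le_trans _ _ ((\int[lebesgue_measure]_(t in F N) edens v t)%:E + e%:E)%E).
  rewrite -EFinD lee_fin; apply: le_trans (edens_between hv s01 inside cW bN sN) _.
  rewrite lerD2l; have := TP _ TN; rewrite /= sub0r normrN.
  move=> /(le_lt_trans (ler_norm _)); rewrite ltr_pdivlMr ?mulr_gt0 ?envelope_rate_gt0// => h.
  by have := envelope_rate_gt0; move: r0 h; nra.
apply: leeD => //; rewrite fineK//.
apply: ge0_subset_integral => //.
- exact: measurable_itv.
- by apply/measurable_EFinP; exact: mE.
- by move=> t _; rewrite lee_fin edens_ge0.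
Unshelve. all: by end_near. Qed.

End calibration.

(** * Choice of the initial radius *)
Section choice.
Context {R : realType} {n : nat}.
Variables (W : 'rV[R]_n -> R) (c c0 p : R).
Hypotheses (cp : 0 < c) (cc : c < c0) (p2 : 2 <= p) (p6 : p < 6).

(** The smallness conditions under which the calibration at the well a works:
the envelope starts inside the region where W is controlled, its slope is at
most lam in absolute value, its reserve can be filled while crossing an
annulus, and there the potential exceeds the cost of the crossing. *)
Definition admissible (a : 'rV[R]_n) (eps : R) := exists r M lam,
  [/\ radially_monotone_near W a r c0 p,
      forall y, enorm y <= 1 -> W (a + y) <= M * enorm y ^+ 2,
      [/\ 0 < r, 0 < M & 0 < lam], [/\ 0 < eps, eps < 1 & eps < r / 8] &
      [/\ envelope_rate c p * eps <= lam,
        reserve_factor c p M * eps `^ reserve_exponent p < lam * (r / 2) &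
       lam ^+ 2 / 2 + (envelope_rate c p ^+ 2 / 2 + M) * eps ^+ 2 <= c0 * (r / 8) `^ (p - 1) * (r / 8)]].

(** Take lam^2 equal to the lower bound of W on the annulus r / 4 <= rho < r:
half of it pays for lam^2 / 2, and the rest bounds the terms in eps. *)
Lemma admissible_near a : C2 W -> (forall x, 0 <= W x) -> W a = 0 ->
  (exists2 r, 0 < r & radially_monotone_near W a r c0 p) ->
  \forall eps \near 0^'+, admissible a eps.
Proof.
move=> CW W0 Wa [r r0 rad].
have [M M0 MP] := quadratic_bound CW W0 Wa.
pose m := c0 * (r / 8) `^ (p - 1) * (r / 8).
have c00 : 0 < c0 by exact: lt_trans cc.
have r8 : 0 < r / 8 by rewrite divr_gt0.
have m0 : 0 < m by rewrite !mulr_gt0// powR_gt0.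
pose lam := Num.sqrt m.
have lam0 : 0 < lam by rewrite sqrtr_gt0.
have lamE : lam ^+ 2 = m by rewrite sqr_sqrtr// ltW.
have mp := envelope_rate_gt0 cp p2;
 have qp := reserve_exponent_gt0 p6; have Bp := reserve_factor_gt0 cp p2 p6 M0.
have G0 : 0 < envelope_rate c p ^+ 2 / 2 + M by rewrite ltr_wpDl// divr_ge0// sqr_ge0.
have l2 : 0 < lam * (r / 2) / reserve_factor c p M by rewrite divr_gt0// mulr_gt0// divr_gt0.
have pw := (cvgrPdist_lt _ _).1 (powR_cvg0 qp) _ l2.
near=> eps; exists r, M, lam.
have e0 : 0 < eps by near: eps; exact: nbhs_right_gt.
have e1 : eps < 1 by near: eps; exact: nbhs_right_lt.
have er : eps < r / 8 by near: eps; exact: nbhs_right_lt.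
split => //; split => //.
- rewrite mulrC -ler_pdivlMr//; near: eps; apply: nbhs_right_le; exact: divr_gt0.
- have : `|0 - eps `^ reserve_exponent p| < lam * (r / 2) / reserve_factor c p M by near: eps; exact: pw.
  by rewrite sub0r normrN => /(le_lt_trans (ler_norm _)); rewrite ltr_pdivlMr// mulrC.
have h : (envelope_rate c p ^+ 2 / 2 + M) * eps <= m / 2.
  rewrite mulrC -ler_pdivlMr//; near: eps; apply: nbhs_right_le; apply: divr_gt0 => //.
  exact: divr_gt0.
have : (envelope_rate c p ^+ 2 / 2 + M) * eps ^+ 2 <= (envelope_rate c p ^+ 2 / 2 + M) * eps.
  by rewrite ler_wpM2l ?(ltW G0)// expr2 ler_piMr// ltW.
rewrite lamE -/m; lra.
Unshelve. all: by end_near. Qed.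

End choice.

Theorem lemma19 (R : realType) (n : nat) (hn : (1 <= n)%N)
    (W : 'rV[R]_n -> R) (hW : forall x, 0 <= W x)
    (hA1 : C2 W /\ hessian_bounded_below W)
    (hA2 : finite_set (zero_set W))
    (hA3 : nonintegrable_minorant W)
    (c0 p0 : R) (hc0 : 0 < c0) (hp0 : 2 <= p0 < 6)
    (c : R) (hc : 0 < c < c0) :
  exists eps0 : R, 0 < eps0 < 1 /\
    forall (am ap : 'rV[R]_n) (r0 : R),
      W am = 0 -> W ap = 0 -> 0 < r0 ->
      radially_monotone_near W am r0 c0 p0 ->
      radially_monotone_near W ap r0 c0 p0 ->
      forall (v : R -> 'rV[R]_n) (s0 : R) (E : R -> R),
        H1loc v -> (energy W v < +oo)%E ->
        eball ap eps0 (v s0) ->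
        envelope c p0 eps0 s0 E ->
        H1loc (projP ap s0 E v) /\
        (energy W (projP ap s0 E v) <= energy W v)%E.
Proof.
have [CW _] := hA1; have /andP[c_gt0 c_lt] := hc; have /andP[p2 p6] := hp0.
have [zs zE] := (finite_seqP _).1 hA2.
pose P a eps := (exists2 r, 0 < r & radially_monotone_near W a r c0 p0) ->
  admissible W c c0 p0 a eps.
have nearP a : W a = 0 -> \forall eps \near (0:R)^'+, P a eps.
  move=> Wa; have [Hr|Hr] := EM (exists2 r, 0 < r & radially_monotone_near W a r c0 p0).
    have := admissible_near c_gt0 c_lt p2 p6 CW hW Wa Hr.
    by apply: filterS => eps H _.
  by apply: nearW => eps.
(* There are finitely many wells, so one initial radius serves them all; a
   radius of radial monotonicity is chosen beforehand for each well. *)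
have nearAll : \forall eps \near (0:R)^'+, forall a, a \in zs -> P a eps.
  have : forall a, a \in zs -> W a = 0 by move=> a az; have : [set` zs] a by []; rewrite -zE.
  elim: zs {zE} => [_|b zs IH H]; first by apply: nearW.
  have Hb := nearP b (H b (mem_head _ _)).
  have Hz := IH (fun a az => H a ltac:(by rewrite inE az orbT)).
  apply: filterS2 Hb Hz => eps Pb Pz a; rewrite inE => /orP[/eqP ->//|]; exact: Pz.
near (0:R)^'+ => eps.
have He : forall a, a \in zs -> P a eps by near: eps.
have e0 : 0 < eps by near: eps; exact: nbhs_right_gt.
have e1 : eps < 1 by near: eps; exact: nbhs_right_lt.
exists eps; split; first by rewrite e0 e1.
move=> am ap r0 _ Wap r00 _ rad v s0 E hv _ vs envE.
have apz : ap \in zs by have : zero_set W ap by []; rewrite zE.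
have [r [M [lam [rad' MP [rp Mp lp] [_ _ er] [h1 h2 h3]]]]] := He _ apz (ex_intro2 _ _ r0 r00 rad).
case: CW => cW HW _.
by apply: (@projection_energy R n W ap r c0 c p0 M lam eps s0 E).
Unshelve. all: by end_near. Qed.
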